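(* Let $\mathbf{u}^0=(h_1^0,h_2^0,u_1^0,u_2^0,v_1^0,v_2^0)^\top:\mathbb{R}^2\to\mathbb{R}^6$. The two-dimensional two-layer shallow water system, with initial data $\mathbf{u}^0$, is hyperbolic if and only if all of the following hold: (i) $\gamma\in\,]0,1[$; (ii) $\inf_{X\in\mathbb{R}^2}h_1^0(X)>0$ and $\inf_{X\in\mathbb{R}^2}h_2^0(X)>0$; (iii) $\inf_{X\in\mathbb{R}^2}\big[F_{crit}^{-,0}(X)^2-F_x^0(X)^2-F_y^0(X)^2\big]>0$.
   Context: $g>0$ is the gravitational acceleration and $\gamma=\rho_1/\rho_2$ the density ratio. For $\mathbf{u}=(h_1,h_2,u_1,u_2,v_1,v_2)^\top$ the system has principal part $\partial_t\mathbf{u}+\mathsf{A}_x(\mathbf{u})\partial_x\mathbf{u}+\mathsf{A}_y(\mathbf{u})\partial_y\mathbf{u}$ with $$\mathsf{A}_x(\mathbf{u})=\begin{pmatrix}u_1&0&h_1&0&0&0\\0&u_2&0&h_2&0&0\\ g&g&u_1&0&0&0\\ \gamma g&g&0&u_2&0&0\\0&0&0&0&u_1&0\\0&0&0&0&0&u_2\end{pmatrix},\quad \mathsf{A}_y(\mathbf{u})=\begin{pmatrix}v_1&0&0&0&h_1&0\\0&v_2&0&0&0&h_2\\0&0&v_1&0&0&0\\0&0&0&v_2&0&0\\ g&g&0&0&v_1&0\\ \gamma g&g&0&0&0&v_2\end{pmatrix}.$$ Set $\mathsf{A}(\mathbf{u},\theta)=\cos(\theta)\mathsf{A}_x(\mathbf{u})+\sin(\theta)\mathsf{A}_y(\mathbf{u})$.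 Hyperbolicity with initial data $\mathbf{u}^0$ means: there exists $c>0$ such that for all $\theta\in[0,2\pi]$, $\sup_{\tau\in\mathbb{R}}\|\exp(-i\tau\mathsf{A}(\mathbf{u}^0,\theta))\|_{L^2}\le c$, where $\|\cdot\|_{L^2}$ is the norm induced by that of $L^2(\mathbb{R}^2)$. $F_x^0=(u_2^0-u_1^0)/\sqrt{gh_1^0}$, $F_y^0=(v_2^0-v_1^0)/\sqrt{gh_1^0}$, $h^0=h_2^0/h_1^0$. For $\gamma\in\,]0,1[$ and $h>0$ let $$\begin{aligned}q(z)=\;&z^4+(h+1)(\gamma-4)z^3-\big(3(h^2+1)(\gamma-2)-h(\gamma^2-26\gamma+4)\big)z^2\\&+(1+h)\big((h^2+1)(3\gamma-4)+h(-20\gamma^2+10\gamma+8)\big)z-(\gamma-1)\big((h-1)^2+4\gamma h\big)^2;\end{aligned}$$ it has exactly two positive real roots, and $F_{crit}^-(h,\gamma)$ is the square root of the smaller one. Finally $F_{crit}^{-,0}(X)=F_{crit}^-(h^0(X),\gamma)$.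
   Formalization: The initial data are also assumed measurable, with every value essential (no value has a neighbourhood with null preimage), with both depths positive at every point and bounded above; without these the equivalence is ill-defined or false. *)

(* Defs.v *)
From HB Require Import structures.
From mathcomp Require Import all_boot all_order all_algebra.
From mathcomp Require Import all_classical all_reals all_analysis complex.

Set Implicit Arguments.
Unset Strict Implicit.
Unset Printing Implicit Defensive.

Import Order.TTheory GRing.Theory Num.Theory.
Import numFieldNormedType.Exports.

Local Open Scope classical_set_scope.
Local Open Scope ring_scope.
Local Open Scope complex_scope.

Section State.
Context {R : realType}.
Implicit Types (u : 'cV[R]_6) (g gamma theta : R).

Definition h1 u : R := u (inord 0) 0.
Definition h2 u : R := u (inord 1) 0.
Definition u1 u : R := u (inord 2) 0.
Definition u2 u : R := u (inord 3) 0.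
Definition v1 u : R := u (inord 4) 0.
Definition v2 u : R := u (inord 5) 0.

Definition mx6 (rows : seq (seq R)) : 'M[R]_6 :=
  \matrix_(i, j) nth 0 (nth [::] rows i) j.

Definition Ax g gamma u : 'M[R]_6 := mx6
  [:: [:: u1 u     ; 0    ; h1 u ; 0    ; 0    ; 0    ];
      [:: 0        ; u2 u ; 0    ; h2 u ; 0    ; 0    ];
      [:: g        ; g    ; u1 u ; 0    ; 0    ; 0    ];
      [:: gamma * g; g    ; 0    ; u2 u ; 0    ; 0    ];
      [:: 0        ; 0    ; 0    ; 0    ; u1 u ; 0    ];
      [:: 0        ; 0    ; 0    ; 0    ; 0    ; u2 u ]].

Definition Ay g gamma u : 'M[R]_6 := mx6
  [:: [:: v1 u     ; 0    ; 0    ; 0    ; h1 u ; 0    ];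
      [:: 0        ; v2 u ; 0    ; 0    ; 0    ; h2 u ];
      [:: 0        ; 0    ; v1 u ; 0    ; 0    ; 0    ];
      [:: 0        ; 0    ; 0    ; v2 u ; 0    ; 0    ];
      [:: g        ; g    ; 0    ; 0    ; v1 u ; 0    ];
      [:: gamma * g; g    ; 0    ; 0    ; 0    ; v2 u ]].

Definition Atheta g gamma u theta : 'M[R]_6 :=
  cos theta *: Ax g gamma u + sin theta *: Ay g gamma u.

Definition Fx g u : R := (u2 u - u1 u) / Num.sqrt (g * h1 u).
Definition Fy g u : R := (v2 u - v1 u) / Num.sqrt (g * h1 u).

Definition q (h gamma z : R) : R :=
  z ^+ 4 + (h + 1) * (gamma - 4) * z ^+ 3
  - (3 * (h ^+ 2 + 1) * (gamma - 2) - h * (gamma ^+ 2 - 26 * gamma + 4))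
      * z ^+ 2
  + (1 + h) * ((h ^+ 2 + 1) * (3 * gamma - 4)
               + h * (- 20 * gamma ^+ 2 + 10 * gamma + 8)) * z
  - (gamma - 1) * ((h - 1) ^+ 2 + 4 * gamma * h) ^+ 2.

(* For [0 < gamma < 1] and [0 < h] the set below has exactly two elements, so
   that [inf] is the smaller one. *)
Definition Fcrit_minus (h gamma : R) : R :=
  Num.sqrt (inf [set z : R | 0 < z /\ q h gamma z = 0]).

Definition Fcrit_minus0 gamma u : R := Fcrit_minus (h2 u / h1 u) gamma.

End State.

Section MatrixExponential.
Context {R : realType} {n : nat}.
Implicit Type M : 'M[R[i]]_n.

Definition expmx_partial M (N : nat) : 'M[R[i]]_n :=
  \sum_(k < N) (k`!%:R)^-1 *: M ^+ k.

(* The sum of the exponential series, the limit being taken in each entry,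
   separately for the real and the imaginary part. *)
Definition expmx M : 'M[R[i]]_n := \matrix_(i, j)
  (limn (fun N => complex.Re (expmx_partial M N i j) : R)
   +i* limn (fun N => complex.Im (expmx_partial M N i j) : R)).

End MatrixExponential.

Section L2.
Context {R : realType}.

Local Notation lebesgue2 := (@lebesgue_measure R \x @lebesgue_measure R)%E.

Definition cnorm {n} (z : 'cV[R[i]]_n) : R :=
  Num.sqrt (\sum_j (complex.Re (z j 0) ^+ 2 + complex.Im (z j 0) ^+ 2)).

Definition measurable_cvec {n} (f : R * R -> 'cV[R[i]]_n) : Prop :=
  forall j, measurable_fun setT (fun X => complex.Re (f X j 0)) /\
            measurable_fun setT (fun X => complex.Im (f X j 0)).

Definition L2norm {n} (f : R * R -> 'cV[R[i]]_n) : \bar R :=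
  Lnorm lebesgue2 2%:E (fun X => (cnorm (f X))%:E).

(* Norm of the multiplication operator [f |-> M f] of L^2(R^2; C^n); it is
   [+oo] when this operator is not bounded. *)
Definition L2opnorm {n} (M : R * R -> 'M[R[i]]_n) : \bar R :=
  ereal_sup [set L2norm (fun X => M X *m f X) | f in
    [set f : R * R -> 'cV[R[i]]_n | measurable_cvec f /\ (L2norm f <= 1)%E]].

(* No value of [u] has a neighbourhood with a negligible preimage. Every
   measurable function is almost everywhere equal to one with this property,
   and a continuous function has it. L^2 operator norms do not see negligible
   sets: this choice of representative makes the infimum of a continuous
   function of [u X] equal to its essential infimum. *)
Definition values_essential (u : R * R -> 'cV[R]_6) : Prop :=
  forall X (V : set 'cV[R]_6), nbhs (u X) V ->
    ~ lebesgue2.-negligible (u @^-1` V).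

Lemma continuous_values_essential (u : R * R -> 'cV[R]_6) :
  continuous u -> values_essential u.
Proof.
move=> cu [a b] V /(cu (a, b)) [[A B] /= [Aa Bb] ABV] uV0.
case/nbhs_ballP: Aa => e /= e0 eA; case/nbhs_ballP: Bb => d /= d0 dB.
have me : measurable (ball a e : set (measurableTypeR R)).
  exact: measurable_realfun.measurable_ball.
have md : measurable (ball b d : set (measurableTypeR R)).
  exact: measurable_realfun.measurable_ball.
have : lebesgue2.-negligible (ball a e `*` ball b d).
  apply: negligibleS uV0 => -[x y] [/= /eA Ax /dB By]; exact: (ABV (x, y)).
move=> /(negligibleP lebesgue2 (measurableX me md)).
move=> /(etrans (esym (product_measure1E _ _ me md))) ab0.
have : ((e *+ 2)%:E * (d *+ 2)%:E = 0 :> \bar R)%E.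
  by rewrite -(lebesgue_measure_ball a (ltW e0))
             -(lebesgue_measure_ball b (ltW d0)); exact: ab0.
rewrite -EFinM => -[] /eqP.
by rewrite mulf_eq0 !mulrn_eq0/= (gt_eqF e0) (gt_eqF d0).
Qed.

Definition hyperbolic (g gamma : R) (u0 : R * R -> 'cV[R]_6) : Prop :=
  exists c : R, 0 < c /\ forall theta : R, 0 <= theta <= 2 * pi ->
    (ereal_sup [set L2opnorm (fun X => expmx
         ((- ('i * tau%:C)) *: map_mx (real_complex R)
                                 (Atheta g gamma (u0 X) theta)))
       | tau in [set: R]] <= c%:E)%E.

End L2.

(* Main.v *)
Require Import Defs.
From HB Require Import structures.
From mathcomp Require Import all_boot all_order all_algebra.
From mathcomp Require Import all_classical all_reals all_analysis complex.
From mathcomp Require Import polyrcf measurable_realfun ring lra.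

(** The operator norm of multiplication by a matrix field on L^2 is the
    essential supremum of the pointwise norms. Since the exponential depends
    continuously on its argument and the values of [u0] are essential,
    hyperbolicity says that exp(-i tau A(u0(X), theta)) is bounded uniformly in
    tau, theta and X ([hyperbolic_stable], [stable_hyperbolic]). What remains is
    a question about one 6 x 6 matrix, to be answered with uniform constants.

    Split C^6 along the direction theta. The velocity components orthogonal to
    theta decouple and are transported, each by its own real speed. The other
    four unknowns form an invariant subspace; after subtraction of the speed of
    the first layer and division by sqrt(g h1), the eigenvalues on it are the
    roots s of the dispersion relation
<<
      (s^2 - 1) ((s - F)^2 - h) = gamma h,       h = h2 / h1,
>>
    where F is the projection on theta of the vector (Fx, Fy); as theta varies,
    F takes all values of modulus at most the Euclidean norm of (Fx, Fy).

    The discriminant of this quartic is 16 h q(F^2) ([discriminant_dispersion]).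
    One root below -1 and one root above 1 always exist, so a positive
    discriminant forces four distinct real roots; hence F^2 < Fcrit^2 is the
    region of strict hyperbolicity that contains F = 0. Everything lies in
    making this quantitative.

    Sufficiency. If F^2 <= Fcrit^2 - delta, a root with s^2 < 1 and
    (s - F')^2 < h exists for some F'^2 = F^2 + delta / 2, and contracting it by
    the factor F / F' gives a point where the quartic of F is larger than a
    positive constant ([dispersion_shrink]); this isolates the two inner roots
    from each other, and the sign of the quartic isolates the outer ones
    ([uniform_gaps]). On vectors annihilated by a product of factors A - l with
    separated real l, the exponential is bounded in terms of the separation
    ([spectral_bound]), whence [propagator_bounded].

    Necessity. If v and w are eigenvectors with distinct real eigenvalues l and
    m, then at tau = pi / (l - m) the exponential turns v - w into a unit
    multiple of v + w ([eigen_separation]). The eigenvectors [wave] are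
    polynomial in the eigenvalue and have first component 1, so the eigenvalues
    stay apart, the discriminant is bounded below, and q being Lipschitz and zero
    at Fcrit^2 keeps F^2 away from Fcrit^2 ([zcrit_margin], [stable_margin]). The
    same estimate at F = 0, for the modes s and - s, bounds the depths from
    below ([stable_depth]). Finally, if gamma >= 1 then at F = 0 the square of
    the shifted symbol has an eigenvalue mu <= 0, and the exponential grows at
    least linearly ([stable_gamma_lt1]). *)

Set Implicit Arguments.
Unset Strict Implicit.
Unset Printing Implicit Defensive.

Import Order.TTheory GRing.Theory Num.Theory.
Import numFieldNormedType.Exports.
Import ComplexField.Normc.

Local Open Scope classical_set_scope.
Local Open Scope ring_scope.

(** * The dispersion relation and its discriminant *)

Section Dispersion.
Context {R : realType}.
Implicit Types (F h gamma s : R).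

Definition dispersion F h gamma s : R :=
  (s ^+ 2 - 1) * ((s - F) ^+ 2 - h) - gamma * h.

(** Vieta's relations, that is, the coefficients of the expanded dispersion
    relation: they hold for the full list of roots with multiplicities, and are
    what the annihilation of the symbol and the discriminant both need. *)
Definition is_dispersion_roots F h gamma (s1 s2 s3 s4 : R) : Prop :=
  [/\ s1 + s2 + s3 + s4 = 2 * F,
      s1 * s2 + s1 * s3 + s1 * s4 + s2 * s3 + s2 * s4 + s3 * s4
        = F ^+ 2 - h - 1,
      s1 * s2 * s3 + s1 * s2 * s4 + s1 * s3 * s4 + s2 * s3 * s4 = - 2 * F
    & s1 * s2 * s3 * s4 = h - F ^+ 2 - gamma * h].

Lemma dispersion_roots_eq0 F h gamma s1 s2 s3 s4 :
  is_dispersion_roots F h gamma s1 s2 s3 s4 ->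
  [/\ dispersion F h gamma s1 = 0, dispersion F h gamma s2 = 0,
      dispersion F h gamma s3 = 0 & dispersion F h gamma s4 = 0].
Proof.
case=> e1 e2 e3 e4.
have E s : dispersion F h gamma s = (s - s1) * (s - s2) * (s - s3) * (s - s4).
  transitivity (s ^+ 4 - (s1 + s2 + s3 + s4) * s ^+ 3
    + (s1 * s2 + s1 * s3 + s1 * s4 + s2 * s3 + s2 * s4 + s3 * s4) * s ^+ 2
    - (s1 * s2 * s3 + s1 * s2 * s4 + s1 * s3 * s4 + s2 * s3 * s4) * s
    + s1 * s2 * s3 * s4); last by ring.
  by rewrite e1 e2 e3 e4 /dispersion; ring.
by split; rewrite E; ring.
Qed.

(** Newton's divided differences of a polynomial vanish at its distinct roots;
    [D2] and [D3] below are the first and second ones, and the third one gives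
    the sum of the roots. *)
Lemma dispersion_roots_of_distinct F h gamma s1 s2 s3 s4 :
  s1 != s2 -> s1 != s3 -> s1 != s4 -> s2 != s3 -> s2 != s4 -> s3 != s4 ->
  dispersion F h gamma s1 = 0 -> dispersion F h gamma s2 = 0 ->
  dispersion F h gamma s3 = 0 -> dispersion F h gamma s4 = 0 ->
  is_dispersion_roots F h gamma s1 s2 s3 s4.
Proof.
move=> d12 d13 d14 d23 d24 d34 p1 p2 p3 p4.
have nz (x y : R) : x != y -> x - y != 0 by rewrite subr_eq0.
pose a3 : R := - 2 * F; pose a2 : R := F ^+ 2 - h - 1; pose a1 : R := 2 * F.
pose D2 x y := x ^+ 3 + x ^+ 2 * y + x * y ^+ 2 + y ^+ 3
  + a3 * (x ^+ 2 + x * y + y ^+ 2) + a2 * (x + y) + a1.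
have D2E x y : x != y -> dispersion F h gamma x = 0 ->
    dispersion F h gamma y = 0 -> D2 x y = 0.
  move=> xy px py; apply: (mulfI (nz _ _ xy)); rewrite mulr0.
  by rewrite -[RHS](subrr 0) -{1}px -py /D2 /dispersion /a3 /a2 /a1; ring.
pose D3 x y z := x ^+ 2 + y ^+ 2 + z ^+ 2 + x * y + x * z + y * z
  + a3 * (x + y + z) + a2.
have D3E x y z : x != y -> D2 x z = 0 -> D2 y z = 0 -> D3 x y z = 0.
  move=> xy px py; apply: (mulfI (nz _ _ xy)); rewrite mulr0.
  by rewrite -[RHS](subrr 0) -{1}px -py /D2 /D3; ring.
have t134 : D3 s1 s3 s4 = 0 by apply: D3E => //; exact: D2E.
have t234 : D3 s2 s3 s4 = 0 by apply: D3E => //; exact: D2E.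
have t34 : D2 s3 s4 = 0 by exact: D2E.
have e1 : s1 + s2 + s3 + s4 + a3 = 0.
  apply: (mulfI (nz _ _ d12)); rewrite mulr0.
  by rewrite -[RHS](subrr 0) -{1}t134 -t234 /D3; ring.
have E3 : a3 = - (s1 + s2 + s3 + s4) by lra.
have E2 : a2 = s1 * s2 + s1 * s3 + s1 * s4 + s2 * s3 + s2 * s4 + s3 * s4.
  by apply/eqP; rewrite -subr_eq0 -t234 /D3 E3; apply/eqP; ring.
have E1 : a1 = - (s1 * s2 * s3 + s1 * s2 * s4 + s1 * s3 * s4 + s2 * s3 * s4).
  by apply/eqP; rewrite -subr_eq0 -t34 /D2 E3 E2; apply/eqP; ring.
split.
- by move: E3; rewrite /a3; lra.
- by rewrite -E2.
- by move: E1; rewrite /a1; lra.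
- have : s4 ^+ 4 + a3 * s4 ^+ 3 + a2 * s4 ^+ 2 + a1 * s4 =
         F ^+ 2 - h + gamma * h.
    by rewrite -[RHS]addr0 -p4 /dispersion /a3 /a2 /a1; ring.
  rewrite E3 E2 E1 => e.
  suff : - (s1 * s2 * s3 * s4) = F ^+ 2 - h + gamma * h by lra.
  by rewrite -e; ring.
Qed.

(** The polynomial [q] of the critical Froude number is, up to the positive
    factor 16 h, the discriminant of the dispersion relation. Two roots x and y
    are split off and the complementary factor z^2 + b z + c is kept, because
    its own discriminant is the unknown sign. *)
Lemma discriminant_dispersion F h gamma (x y b c : R) :
  b - x - y = - 2 * F -> c - b * (x + y) + x * y = F ^+ 2 - h - 1 ->
  b * (x * y) - c * (x + y) = 2 * F ->
  c * (x * y) = h - F ^+ 2 - gamma * h ->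
  16 * h * q h gamma (F ^+ 2) =
  (x - y) ^+ 2 * (b ^+ 2 - 4 * c) *
  ((x ^+ 2 + b * x + c) * (y ^+ 2 + b * y + c)) ^+ 2.
Proof.
move=> e3 e2 e1 e0.
(* The discriminant of X^4 + a X^3 + b X^2 + c X + d. *)
pose disc (a b c d : R) := 
  256 * d ^+ 3 - 192 * a * c * d ^+ 2 - 128 * b ^+ 2 * d ^+ 2
  + 144 * b * c ^+ 2 * d - 27 * c ^+ 4
  + 144 * a ^+ 2 * b * d ^+ 2 - 6 * a ^+ 2 * c ^+ 2 * d
  - 80 * a * b ^+ 2 * c * d + 18 * a * b * c ^+ 3 + 16 * b ^+ 4 * d
  - 4 * b ^+ 3 * c ^+ 2 - 27 * a ^+ 4 * d ^+ 2 + 18 * a ^+ 3 * b * c * d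
  - 4 * a ^+ 3 * c ^+ 3 - 4 * a ^+ 2 * b ^+ 3 * d + a ^+ 2 * b ^+ 2 * c ^+ 2.
transitivity (disc (- 2 * F) (F ^+ 2 - h - 1) (2 * F) (h - F ^+ 2 - gamma * h)).
  by rewrite /disc /q; ring.
by rewrite -e3 -e2 -e1 -e0 /disc; ring.
Qed.

End Dispersion.

(** * Location of the roots *)

Section Roots.
Context {R : realType}.
Implicit Types (F h gamma s : R).

Lemma dispersion_ivt F h gamma a b : a <= b ->
  dispersion F h gamma a * dispersion F h gamma b < 0 ->
  exists s, [/\ a < s, s < b & dispersion F h gamma s = 0].
Proof.
move=> ab.
pose p : {poly R} := ('X ^+ 2 - 1) * (('X - F%:P) ^+ 2 - h%:P) - (gamma * h)%:P.
have pE s : dispersion F h gamma s = p.[s].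
  by rewrite /p /dispersion !hornerE.
rewrite !pE => /(poly_ivtoo ab) [s]; rewrite in_itv/= => /andP[a_s s_b] /rootP ps.
by exists s; rewrite pE.
Qed.

Lemma q_ivt h gamma a b : a <= b -> q h gamma a * q h gamma b < 0 ->
  exists z, [/\ a < z, z < b & q h gamma z = 0].
Proof.
move=> ab.
pose k2 : R := 3 * (h ^+ 2 + 1) * (gamma - 2) - h * (gamma ^+ 2 - 26 * gamma + 4).
pose k1 : R := (1 + h) * ((h ^+ 2 + 1) * (3 * gamma - 4)
               + h * (- 20 * gamma ^+ 2 + 10 * gamma + 8)).
pose k0 : R := (gamma - 1) * ((h - 1) ^+ 2 + 4 * gamma * h) ^+ 2.
pose p : {poly R} := 'X ^+ 4 + ((h + 1) * (gamma - 4))%:P * 'X ^+ 3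
  - k2%:P * 'X ^+ 2 + k1%:P * 'X - k0%:P.
have pE s : q h gamma s = p.[s] by rewrite /p /q /k0 /k1 /k2 !hornerE.
rewrite !pE => /(poly_ivtoo ab) [s]; rewrite in_itv/= => /andP[a_s s_b] /rootP ps.
by exists s; rewrite pE.
Qed.

(** Beyond 1 + F + sqrt h both factors dominate: the first is at least h and
    the second at least 1. *)
Lemma dispersion_gt0 F h gamma s : 0 <= F -> 0 < h -> gamma < 1 ->
  1 + F + Num.sqrt h <= `|s| -> 0 < dispersion F h gamma s.
Proof.
move=> F0 h0 g1; rewrite /dispersion.
have := sqr_sqrtr (ltW h0); have := sqrtr_gt0 h; rewrite h0.
move: (Num.sqrt h) => r r0 <- rs.
have A : r ^+ 2 <= s ^+ 2 - 1.
  rewrite -[s ^+ 2]real_normK ?num_real//.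
  have : (1 + r) ^+ 2 <= `|s| ^+ 2 by rewrite ler_sqr ?nnegrE; lra.
  nra.
have B : 1 <= (s - F) ^+ 2 - r ^+ 2.
  have sF : 1 + r <= `|s - F|.
    by have := lerB_dist s F; rewrite (ger0_norm F0); lra.
  rewrite -[(s - F) ^+ 2]real_normK ?num_real//.
  have : (1 + r) ^+ 2 <= `|s - F| ^+ 2 by rewrite ler_sqr ?nnegrE; lra.
  nra.
have : r ^+ 2 * 1 <= (s ^+ 2 - 1) * ((s - F) ^+ 2 - r ^+ 2).
  by apply: ler_pM => //; rewrite sqr_ge0.
have := exprn_gt0 2 r0; nra.
Qed.

Lemma dispersion_root_lt F h gamma s : 0 <= F -> 0 < h -> gamma < 1 ->
  dispersion F h gamma s = 0 -> `|s| < 1 + F + Num.sqrt h.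
Proof.
move=> F0 h0 g1 s0; rewrite ltNge; apply/negP => /dispersion_gt0.
by move=> /(_ gamma F0 h0 g1); rewrite s0 ltxx.
Qed.

Lemma dispersion_outer_roots F h gamma : 0 <= F -> 0 < h -> 0 < gamma < 1 ->
  exists x y, [/\ x < -1, 1 < y, dispersion F h gamma x = 0
                & dispersion F h gamma y = 0].
Proof.
move=> F0 h0 /andP[g0 g1]; have r0 : 0 < Num.sqrt h by rewrite sqrtr_gt0.
pose r := 1 + F + Num.sqrt h.
have r1 : 1 < r by rewrite /r; lra.
have gh0 : 0 < gamma * h by rewrite mulr_gt0.
have [] := @dispersion_ivt F h gamma (- r) (-1); first by lra.
  rewrite nmulr_llt0 ?dispersion_gt0// /r ?normrN ?ler_norm//.
  by rewrite /dispersion; lra.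
move=> x [_ x1 px].
have [] := @dispersion_ivt F h gamma 1 r; first by lra.
  rewrite pmulr_llt0 ?dispersion_gt0// /r ?ler_norm//.
  by rewrite /dispersion; lra.
move=> y [y1 _ py].
by exists x, y.
Qed.

(** The two outer roots contribute squares to the discriminant, which is
    therefore positive only if the quadratic factor left over has two distinct
    real roots, different from the outer ones. *)
Lemma dispersion_four_roots F h gamma : 0 <= F -> 0 < h -> 0 < gamma < 1 ->
  0 < q h gamma (F ^+ 2) ->
  exists x y s t, [/\ x < -1, 1 < y, x != s & x != t] /\
   [/\ y != s, y != t, s < t & is_dispersion_roots F h gamma x s t y].
Proof.
move=> F0 h0 g01 q0.
have [x [y [x1 y1 px py]]] := dispersion_outer_roots F0 h0 g01.
have xy : x < y by lra.
pose b := x + y - 2 * F.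
pose c := F ^+ 2 - h - 1 + b * (x + y) - x * y.
have al : 2 * F - (b * (x * y) - c * (x + y)) = 0.
  have xy0 : x - y != 0 by rewrite subr_eq0 (lt_eqF xy).
  apply: (mulfI xy0); rewrite mulr0 -[RHS](subrr 0) -{1}px -py.
  by rewrite /dispersion /c /b; ring.
have be : h - F ^+ 2 - gamma * h - c * (x * y) = 0.
  have : (2 * F - (b * (x * y) - c * (x + y))) * x +
     (h - F ^+ 2 - gamma * h - c * (x * y)) = 0.
     by rewrite -px /dispersion /c /b; ring.
  by rewrite al mul0r add0r.
have := @discriminant_dispersion _ F h gamma x y b c.
have -> : b - x - y = - 2 * F by rewrite /b; ring.
have -> : c - b * (x + y) + x * y = F ^+ 2 - h - 1 by rewrite /c; ring.
move=> /(_ erefl erefl).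
have e1 : b * (x * y) - c * (x + y) = 2 * F by lra.
have e0 : c * (x * y) = h - F ^+ 2 - gamma * h by lra.
move=> /(_ e1 e0) D.
have D0 : 0 < (x - y) ^+ 2 * (b ^+ 2 - 4 * c) *
  ((x ^+ 2 + b * x + c) * (y ^+ 2 + b * y + c)) ^+ 2.
  by rewrite -D !mulr_gt0.
pose Q s := s ^+ 2 + b * s + c.
have d0 : 0 < b ^+ 2 - 4 * c.
  move: D0; apply: contraTT; rewrite -!leNgt => d0.
  by rewrite mulr_le0_ge0 ?sqr_ge0// mulr_ge0_le0// sqr_ge0.
have Qx : Q x != 0.
  by apply: contraTneq D0; rewrite /Q => ->; rewrite mul0r expr0n/= mulr0 ltxx.
have Qy : Q y != 0.
  by apply: contraTneq D0; rewrite /Q => ->; rewrite mulr0 expr0n/= mulr0 ltxx.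
have := sqr_sqrtr (ltW d0); have := sqrtr_gt0 (b ^+ 2 - 4 * c); rewrite d0.
move: (Num.sqrt _) => e e_gt0 eE.
pose s := (- b - e) / 2; pose t := (- b + e) / 2.
have cE : c = (b ^+ 2 - e ^+ 2) / 4 by rewrite eE; field.
have Qs : Q s = 0 by rewrite /Q cE /s; field.
have Qt : Q t = 0 by rewrite /Q cE /t; field.
exists x, y, s, t; split; split => //.
- by apply: contraNneq Qx => ->; rewrite Qs.
- by apply: contraNneq Qx => ->; rewrite Qt.
- by apply: contraNneq Qy => ->; rewrite Qs.
- by apply: contraNneq Qy => ->; rewrite Qt.
- by rewrite /s /t; lra.
- have st : s + t = - b by rewrite /s /t; field.
  have st' : s * t = c by rewrite cE /s /t; field.
  split.
  + transitivity (x + y + (s + t)); first by ring.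
    by rewrite st /b; ring.
  + transitivity (x * y + (s + t) * (x + y) + s * t); first by ring.
    by rewrite st st' /c; ring.
  + transitivity (x * y * (s + t) + s * t * (x + y)); first by ring.
    by rewrite st st'; lra.
  + transitivity (s * t * (x * y)); first by ring.
    by rewrite st' e0.
Qed.

(** Both factors are decreasing and positive on the left of the two intervals
    where they are negative. *)
Lemma dispersion_left_inj F h gamma s t : 0 <= F -> 0 < h -> 0 < gamma ->
  s < -1 -> t < -1 -> h < (s - F) ^+ 2 -> h < (t - F) ^+ 2 ->
  dispersion F h gamma s = 0 -> dispersion F h gamma t = 0 -> s = t.
Proof.
move=> F0 h0 g0.
wlog st : s t / s <= t.
  move=> H s1 t1 sF tF ps pt.
  by have [st|/ltW ts] := leP s t; [|symmetry]; exact: H.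
move=> s1 t1 sF tF; rewrite /dispersion => /eqP + /eqP.
rewrite !subr_eq0 => /eqP ps /eqP pt.
apply/eqP; rewrite eq_le st/= leNgt; apply/negP => {}st.
suff : (t ^+ 2 - 1) * ((t - F) ^+ 2 - h) < (s ^+ 2 - 1) * ((s - F) ^+ 2 - h).
  by rewrite ps pt ltxx.
apply: ltr_pM.
- nra.
- lra.
- nra.
- nra.
Qed.

Lemma dispersion_right_inj F h gamma s t : 0 < h -> 0 < gamma ->
  1 < s -> 1 < t -> F + Num.sqrt h < s -> F + Num.sqrt h < t ->
  dispersion F h gamma s = 0 -> dispersion F h gamma t = 0 -> s = t.
Proof.
move=> h0 g0.
wlog st : s t / s <= t.
  move=> H s1 t1 sF tF ps pt.
  by have [st|/ltW ts] := leP s t; [|symmetry]; exact: H.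
have := sqr_sqrtr (ltW h0); have := sqrtr_gt0 h; rewrite h0.
move: (Num.sqrt h) => r r0 rh s1 t1 sF tF.
rewrite /dispersion => /eqP + /eqP.
rewrite !subr_eq0 => /eqP ps /eqP pt.
apply/eqP; rewrite eq_le st/= leNgt; apply/negP => {}st.
suff : (s ^+ 2 - 1) * ((s - F) ^+ 2 - h) < (t ^+ 2 - 1) * ((t - F) ^+ 2 - h).
  by rewrite ps pt ltxx.
by apply: ltr_pM; rewrite -?rh; nra.
Qed.

Lemma sqr_lt_itv (x r : R) : 0 <= r -> x ^+ 2 < r ^+ 2 -> - r < x /\ x < r.
Proof.
move=> r0 xr; apply/andP; rewrite -ltr_norml -ltr_sqr ?nnegrE//.
by rewrite real_normK ?num_real.
Qed.

(** A root larger than 1 cannot lie in the gap between the two intervals,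
    which is empty when F <= 1 + sqrt h. *)
Lemma dispersion_right_root F h gamma s : F <= 1 + Num.sqrt h -> 0 < h ->
  0 < gamma -> 1 < s -> dispersion F h gamma s = 0 -> F + Num.sqrt h < s.
Proof.
move=> F1 h0 g0 s1 /eqP; rewrite subr_eq0 => /eqP ps.
rewrite ltNge; apply/negP => sF.
have c : (s - F) ^+ 2 <= h.
  rewrite -(sqr_sqrtr (ltW h0)) -[(s - F) ^+ 2]real_normK ?num_real//.
  by rewrite ler_sqr ?nnegrE ?sqrtr_ge0// ler_norml; lra.
have : (s ^+ 2 - 1) * ((s - F) ^+ 2 - h) <= 0.
  by apply: mulr_ge0_le0; rewrite ?subr_le0 ?subr_ge0// exprn_ege1 ?ltW.
by rewrite ps leNgt mulr_gt0.
Qed.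

(** The product of the two factors is gamma h > 0 at a root, so they have the
    same sign; both are positive for at most one root on each side, hence a third
    root makes both negative. *)
Lemma dispersion_inner_root F h gamma : 0 <= F <= 1 + Num.sqrt h -> 0 < h ->
  0 < gamma < 1 -> 0 < q h gamma (F ^+ 2) ->
  exists s, [/\ dispersion F h gamma s = 0, s ^+ 2 < 1 & (s - F) ^+ 2 < h].
Proof.
move=> /andP[F0 F1] h0 g01 q0.
have [x [y [s [t [[x1 y1 xs _] [ys _ _]]]]]] := dispersion_four_roots F0 h0 g01 q0.
move=> /dispersion_roots_eq0[px ps _ py].
case/andP: g01 => g0 g1.
have gh : 0 < gamma * h by rewrite mulr_gt0.
have sgn u : dispersion F h gamma u = 0 ->
    (1 < u ^+ 2 /\ h < (u - F) ^+ 2) \/ (u ^+ 2 < 1 /\ (u - F) ^+ 2 < h).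
  rewrite /dispersion => /eqP; rewrite subr_eq0 => /eqP pu.
  have [u1|u1|u1] := ltgtP (u ^+ 2) 1.
  - right; split => //; rewrite ltNge; apply/negP => uh.
    have : (u ^+ 2 - 1) * ((u - F) ^+ 2 - h) <= 0.
      by rewrite mulr_le0_ge0; lra.
    lra.
  - left; split => //; rewrite ltNge; apply/negP => uh.
    have : (u ^+ 2 - 1) * ((u - F) ^+ 2 - h) <= 0.
      by rewrite mulr_ge0_le0; lra.
    lra.
  - by move: pu; rewrite u1; lra.
have [[s1 sF]|[s1 sF]] := sgn _ ps; last by exists s.
have [s_lt|s_gt] : s < -1 \/ 1 < s.
    move: s1; rewrite -subr_gt0 (_ : s ^+ 2 - 1 = (s - 1) * (s + 1)); last by ring.
    have [?|?] := ltP 1 s; [by right|left; nra].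
- exfalso; move/eqP: xs; apply.
  apply: (@dispersion_left_inj F h gamma) => //.
  by have [[]|[]] := sgn _ px => //; nra.
- exfalso; move/eqP: ys; apply.
  by apply: (@dispersion_right_inj F h gamma) => //;
    apply: (dispersion_right_root F1 h0 g0).
Qed.

End Roots.

(** * The critical Froude number *)

Section Critical.
Context {R : realType}.
Implicit Types (F h gamma s z : R).

Lemma dispersion_lipschitz F h gamma B H s t : `|F| <= B -> `|h| <= H ->
  `|s| <= B -> `|t| <= B ->
  `|dispersion F h gamma s - dispersion F h gamma t| <=
  (2 * B * (4 * B ^+ 2 + H) + (B ^+ 2 + 1) * (4 * B)) * `|s - t|.
Proof.
move=> FB hH sB tB.
have B0 : 0 <= B by apply: le_trans sB.
have -> : dispersion F h gamma s - dispersion F h gamma t =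
  ((s + t) * ((s - F) ^+ 2 - h) + (t ^+ 2 - 1) * ((s - F) + (t - F))) * (s - t).
  by rewrite /dispersion; ring.
rewrite normrM ler_wpM2r//.
have nD (x y X Y : R) : `|x| <= X -> `|y| <= Y -> `|x + y| <= X + Y.
  by move=> xX yY; rewrite (le_trans (ler_normD _ _))// lerD.
have nM (x y X Y : R) : `|x| <= X -> `|y| <= Y -> `|x * y| <= X * Y.
  by move=> xX yY; rewrite normrM ler_pM.
have sF : `|s - F| <= 2 * B.
  by rewrite mulr_natl mulr2n; apply: (nD); rewrite ?normrN.
have tF : `|t - F| <= 2 * B.
  by rewrite mulr_natl mulr2n; apply: (nD); rewrite ?normrN.
apply: (nD); apply: (nM).
- by rewrite mulr_natl mulr2n; apply: (nD).
- apply: (nD); rewrite ?normrN// normrX.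
  rewrite (_ : 4 * B ^+ 2 = (2 * B) ^+ 2); last by ring.
  by rewrite lerXn2r ?nnegrE// mulr_ge0.
- by apply: (nD); rewrite ?normrN1// normrX lerXn2r ?nnegrE.
- by rewrite (_ : 4 * B = 2 * B + 2 * B); [exact: (nD)|ring].
Qed.

(** The Lipschitz constant replaces every variable in the divided difference of
    [q] by its maximum, and every sign by +; the 1 makes it positive. *)
Lemma q_lipschitz (H Z : R) : 0 <= H -> 0 <= Z -> exists2 L, 0 < L &
  forall h gamma z w, 0 < gamma < 1 -> 0 < h <= H -> 0 <= z <= Z ->
    0 <= w <= Z -> `|q h gamma z - q h gamma w| <= L * `|z - w|.
Proof.
move=> H0 Z0.
have nD (x y X Y : R) : `|x| <= X -> `|y| <= Y -> `|x + y| <= X + Y.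
  by move=> xX yY; rewrite (le_trans (ler_normD _ _))// lerD.
have nM (x y X Y : R) : `|x| <= X -> `|y| <= Y -> `|x * y| <= X * Y.
  by move=> xX yY; rewrite normrM ler_pM.
have nX (x X : R) k : `|x| <= X -> `|x ^+ k| <= X ^+ k.
  by move=> xX; rewrite normrX lerXn2r ?nnegrE// (le_trans _ xX).
pose K2 : R := 3 * (H ^+ 2 + 1) * (1 + 2) + H * (1 ^+ 2 + 26 * 1 + 4).
pose K1 : R := (1 + H) * ((H ^+ 2 + 1) * (3 * 1 + 4)
               + H * (20 * 1 ^+ 2 + 10 * 1 + 8)).
exists (1 + ((Z ^+ 3 + Z ^+ 2 * Z + Z * Z ^+ 2 + Z ^+ 3) +
        (H + 1) * (1 + 4) * (Z ^+ 2 + Z * Z + Z ^+ 2) +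
        K2 * (Z + Z) + K1)).
  by rewrite ltr_wpDr// ?/K1 ?/K2 ?addr_ge0 ?mulr_ge0 ?addr_ge0 ?mulr_ge0
    ?exprn_ge0 ?addr_ge0 ?mulr_ge0 ?exprn_ge0 ?addr_ge0 ?exprn_ge0.
move=> h gamma z w /andP[g0 g1] /andP[h0 hH] /andP[z0 zZ] /andP[w0 wZ].
have {}g1 : `|gamma| <= 1 by rewrite gtr0_norm// ltW.
have {}hH : `|h| <= H by rewrite gtr0_norm.
have {}zZ : `|z| <= Z by rewrite ger0_norm.
have {}wZ : `|w| <= Z by rewrite ger0_norm.
have nN (x X : R) : `|x| <= X -> `|- x| <= X by rewrite normrN.
have n1 (k : R) : 0 <= k -> `|k| <= k by move=> k0; rewrite ger0_norm.
have -> : q h gamma z - q h gamma w =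
  (z ^+ 3 + z ^+ 2 * w + z * w ^+ 2 + w ^+ 3
   + (h + 1) * (gamma - 4) * (z ^+ 2 + z * w + w ^+ 2)
   - (3 * (h ^+ 2 + 1) * (gamma - 2) - h * (gamma ^+ 2 - 26 * gamma + 4))
      * (z + w)
   + (1 + h) * ((h ^+ 2 + 1) * (3 * gamma - 4)
               + h * (- 20 * gamma ^+ 2 + 10 * gamma + 8))) * (z - w).
  by rewrite /q; ring.
rewrite normrM ler_wpM2r// (@le_trans _ _ (Z ^+ 3 + Z ^+ 2 * Z + Z * Z ^+ 2 + Z ^+ 3 +
        (H + 1) * (1 + 4) * (Z ^+ 2 + Z * Z + Z ^+ 2) +
        K2 * (Z + Z) + K1))//; last by rewrite ler_wpDl.
rewrite /K1 /K2.
by repeat first [done|by rewrite normr1|apply: (n1); exact: ler0n|apply: (nD)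
  |apply: (nN)|apply: (nM)|apply: (nX)].
Qed.

(** The square of the critical Froude number, see [Fcrit_minus_sqr]. *)
Definition zcrit h gamma : R := inf [set z : R | 0 < z /\ q h gamma z = 0].

Lemma q_at0_gt0 h gamma : 0 < h -> 0 < gamma < 1 -> 0 < q h gamma 0.
Proof.
move=> h0 /andP[g0 g1].
have -> : q h gamma 0 = (1 - gamma) * ((h - 1) ^+ 2 + 4 * gamma * h) ^+ 2.
  by rewrite /q; ring.
rewrite mulr_gt0 ?subr_gt0// exprn_gt0// ltr_wpDl ?sqr_ge0//.
by rewrite !mulr_gt0.
Qed.

(** At F = 1 + sqrt h the intervals [-1, 1] and [F - sqrt h, F + sqrt h] share
    only an endpoint, so no inner root exists and q cannot be positive there. *)
Lemma q_pos_root h gamma : 0 < h -> 0 < gamma < 1 ->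
  exists z, [/\ 0 < z, z <= (1 + Num.sqrt h) ^+ 2 & q h gamma z = 0].
Proof.
move=> h0 g01.
set Z := (1 + Num.sqrt h) ^+ 2.
have r0 : 0 < Num.sqrt h by rewrite sqrtr_gt0.
have Z0 : 0 < Z by rewrite exprn_gt0// addr_gt0.
have : q h gamma Z <= 0.
  rewrite leNgt; apply/negP => qZ.
  have F1 : 0 <= 1 + Num.sqrt h <= 1 + Num.sqrt h.
    by rewrite lexx andbT; lra.
  have [s] := dispersion_inner_root F1 h0 g01 qZ.
  move=> [_ s1]; rewrite -[X in _ < X](sqr_sqrtr (ltW h0)) => sF.
  have : s < 1 by nra.
  nra.
rewrite le_eqVlt => /predU1P[qZ|qZ]; first by exists Z.
have [] := @q_ivt _ h gamma 0 Z (ltW Z0).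
  by rewrite pmulr_rlt0// q_at0_gt0.
by move=> z [z0 /ltW zZ qz]; exists z.
Qed.

Lemma zcrit_le h gamma : 0 < h -> 0 < gamma < 1 ->
  zcrit h gamma <= (1 + Num.sqrt h) ^+ 2.
Proof.
move=> h0 g01; have [z [z0 zZ qz]] := q_pos_root h0 g01.
apply: le_trans zZ; apply: ge_inf => //.
by exists 0 => y [/ltW].
Qed.

Lemma zcrit_ge0 h gamma : 0 < h -> 0 < gamma < 1 -> 0 <= zcrit h gamma.
Proof.
move=> h0 g01; apply: lb_le_inf => [|y [/ltW]//].
by have [z [z0 _ qz]] := q_pos_root h0 g01; exists z.
Qed.

Lemma q_gt0 h gamma z : 0 < h -> 0 < gamma < 1 -> 0 <= z < zcrit h gamma ->
  0 < q h gamma z.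
Proof.
move=> h0 g01 /andP[z0 zc].
have noroot y : 0 < y -> y <= z -> q h gamma y = 0 -> False.
  move=> y0 yz qy; suff : zcrit h gamma <= y by lra.
  by apply: ge_inf => //; exists 0 => t [/ltW].
have q0 := q_at0_gt0 h0 g01.
rewrite ltNge le_eqVlt; apply/negP => /predU1P[qz|qz].
- apply: (noroot z) => //; rewrite lt_neqAle z0 andbT eq_sym.
  by apply: contra_eqN qz => /eqP ->; rewrite gt_eqF.
- have [|y [y0 /ltW yz qy]] := @q_ivt _ h gamma 0 z z0.
    by rewrite pmulr_rlt0.
  exact: (noroot y).
Qed.

Lemma q_zcrit h gamma : 0 < h -> 0 < gamma < 1 -> q h gamma (zcrit h gamma) = 0.
Proof.
move=> h0 g01; have c0 := zcrit_ge0 h0 g01.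
have c1 : 0 <= zcrit h gamma + 1 by rewrite addr_ge0.
have [L L0 qL] := q_lipschitz (ltW h0) c1.
apply/eqP; rewrite -normr_le0; apply/ler_addgt0Pl => e e0; rewrite addr0.
have d0 : 0 < Num.min 1 (e / L) by rewrite lt_min ltr01 divr_gt0.
have [|z [z0 qz] zd] := @inf_adherent _ [set z : R | 0 < z /\ q h gamma z = 0] _ d0.
  split; last by exists 0 => y [/ltW].
  by have [z [z0 _ qz]] := q_pos_root h0 g01; exists z.
have cz : zcrit h gamma <= z by apply: ge_inf => //; exists 0 => t [/ltW].
rewrite -/(zcrit h gamma) in zd.
have zd1 : z - zcrit h gamma < 1.
  by rewrite ltrBlDl (lt_le_trans zd)// lerD2l ge_min lexx.
have zd2 : z - zcrit h gamma < e / L.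
  by rewrite ltrBlDl (lt_le_trans zd)// lerD2l ge_min lexx orbT.
have := qL h gamma z (zcrit h gamma) g01.
rewrite h0 lexx qz sub0r normrN => /(_ erefl).
move=> H; apply: le_trans (H _ _) _; [lra|by rewrite c0; lra|].
rewrite ger0_norm ?subr_ge0// mulrC -ler_pdivlMr//.
exact: ltW.
Qed.

Lemma zcrit_gt0 h gamma : 0 < h -> 0 < gamma < 1 -> 0 < zcrit h gamma.
Proof.
move=> h0 g01; rewrite lt_neqAle zcrit_ge0 ?andbT 1?eq_sym ?h0 ?g01 //.
have := q_zcrit h0 g01.
by apply: contra_eqN => /eqP ->; rewrite gt_eqF// q_at0_gt0.
Qed.

Lemma Fcrit_minus_sqr h gamma : 0 < h -> 0 < gamma < 1 ->
  Fcrit_minus h gamma ^+ 2 = zcrit h gamma.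
Proof. by move=> h0 g01; rewrite sqr_sqrtr// zcrit_ge0. Qed.

Lemma subcritical_le h gamma F : 0 < h -> 0 < gamma < 1 -> 0 <= F ->
  F ^+ 2 <= zcrit h gamma -> F <= 1 + Num.sqrt h.
Proof.
move=> h0 g01 F0 Fz.
rewrite -ler_sqr ?nnegrE ?addr_ge0 ?sqrtr_ge0//.
exact: le_trans Fz (zcrit_le h0 g01).
Qed.

(** With t = F / F', the point t s is as far inside both intervals for F as s is
    for F', with a gain: writing a = s^2 and b = (s - F')^2, the dispersion
    function at t s is (1 - t^2) (a h + b - (1 + t^2) a b), which is bounded
    below because a + b >= F'^2 / 2. *)
Lemma dispersion_shrink F F' h gamma s : 0 <= F -> F < F' ->  0 < h ->
  0 < gamma < 1 ->
  dispersion F' h gamma s = 0 -> s ^+ 2 < 1 -> (s - F') ^+ 2 < h ->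
  exists s0, [/\ s0 ^+ 2 < 1, (s0 - F) ^+ 2 < h &
    (F' ^+ 2 - F ^+ 2) * (gamma * Num.min h 1 / 2) <= dispersion F h gamma s0].
Proof.
move=> F0 FF' h0 /andP[g0 g1] ps s1 sF.
have F'0 : 0 < F' by apply: le_lt_trans FF'.
pose t := F / F'.
have t0 : 0 <= t by rewrite divr_ge0// ltW.
have t1 : t < 1 by rewrite ltr_pdivrMr// mul1r.
have tt : t ^+ 2 <= 1 by nra.
have Et : t * F' = F by rewrite /t divfK// gt_eqF.
have sF2 : (t * s - F) ^+ 2 = t ^+ 2 * (s - F') ^+ 2 by rewrite -Et; ring.
have := sqr_ge0 s; have := sqr_ge0 (s - F').
have F'E : F' ^+ 2 <= 2 * (s ^+ 2 + (s - F') ^+ 2).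
  have := sqr_ge0 (s + (s - F')); lra.
move: ps; rewrite /dispersion.
exists (t * s); rewrite exprMn sF2.
move: (s ^+ 2) ((s - F') ^+ 2) ps s1 sF F'E H H0 => a b ps a1 bh F'E b0 a0.
split; [nra|nra|].
rewrite -Et exprMn.
set m := Num.min h 1.
have m0 : 0 < m by rewrite lt_min h0 ltr01.
have mh : m <= h by rewrite ge_min lexx.
have m1 : m <= 1 by rewrite ge_min lexx orbT.
have -> : (t ^+ 2 * a - 1) * (t ^+ 2 * b - h) - gamma * h =
   (1 - t ^+ 2) * (a * h + b - (1 + t ^+ 2) * (a * b)).
  by rewrite -[LHS]subr0 -ps; ring.
rewrite (_ : F' ^+ 2 - _ = (1 - t ^+ 2) * F' ^+ 2); last by ring.
rewrite -[leLHS]mulrA; apply: ler_wpM2l; first by rewrite subr_ge0.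
(* (1 - a) (h - b) = gamma h with 1 - a <= 1 and h - b <= h, so each factor is
   at least gamma times its maximum. *)
have ga : gamma <= 1 - a.
  have : gamma * h <= (1 - a) * h by nra.
  by rewrite ler_pM2r.
have gb : gamma * h <= h - b by nra.
have ab0 : 0 <= a * b by rewrite mulr_ge0.
have e1 : a * h + b - 2 * (a * b) <= a * h + b - (1 + t ^+ 2) * (a * b).
  by rewrite lerD2l lerN2 ler_wpM2r//; lra.
apply: le_trans e1.
have e2 : a * (gamma * h) + b * gamma <= a * h + b - 2 * (a * b).
  have := ler_wpM2l a0 gb; have := ler_wpM2l b0 ga; lra.
apply: le_trans e2.
have e3 : gamma * (m * (a + b)) <= a * (gamma * h) + b * gamma.
  have -> : a * (gamma * h) + b * gamma = gamma * (h * a + 1 * b) by ring.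
  rewrite ler_wpM2l ?(ltW g0)// mulrDr lerD// ler_wpM2r//.
apply: le_trans e3.
have -> : F' ^+ 2 * (gamma * m / 2) = gamma * (m * (F' ^+ 2 / 2)) by ring.
rewrite ler_wpM2l ?(ltW g0)// ler_wpM2l ?(ltW m0)//; lra.
Qed.

End Critical.

(** * Uniform separation of the eigenvalues *)

Section Gaps.
Context {R : realType}.
Implicit Types (F h gamma s z : R).

(** Reversing the direction of propagation exchanges F and - F. *)
Lemma is_dispersion_roots_opp F h gamma s1 s2 s3 s4 :
  is_dispersion_roots (- F) h gamma s1 s2 s3 s4 ->
  is_dispersion_roots F h gamma (- s4) (- s3) (- s2) (- s1).
Proof.
case=> e1 e2 e3 e4; split.
- by transitivity (- (s1 + s2 + s3 + s4)); [ring|rewrite e1; ring].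
- by rewrite -[F]opprK sqrrN -e2; ring.
- by transitivity (- (s1 * s2 * s3 + s1 * s2 * s4 + s1 * s3 * s4
    + s2 * s3 * s4)); [ring|rewrite e3; ring].
- by rewrite -[F]opprK sqrrN -e4; ring.
Qed.

Lemma dispersion_roots_of_increasing F h gamma (d s1 s2 s3 s4 : R) : 0 < d ->
  s1 + d <= s2 -> s2 + d <= s3 -> s3 + d <= s4 ->
  dispersion F h gamma s1 = 0 -> dispersion F h gamma s2 = 0 ->
  dispersion F h gamma s3 = 0 -> dispersion F h gamma s4 = 0 ->
  is_dispersion_roots F h gamma s1 s2 s3 s4.
Proof.
move=> d0 s12 s23 s34.
by apply: dispersion_roots_of_distinct; rewrite lt_eqF//; lra.
Qed.

(** Between an inner point where the dispersion function is at least eps, given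
    by [dispersion_shrink], and the endpoints of the common interval, where it is
    - gamma h, lie two inner roots; a Lipschitz bound turns these values into
    distances. The outer roots are beyond the endpoints. *)
Lemma uniform_gaps_ge0 gamma m H delta : 0 < gamma < 1 -> 0 < m -> m <= H ->
  0 < delta ->
  exists2 d, 0 < d & forall h F, m <= h <= H -> 0 <= F ->
    F ^+ 2 + delta <= zcrit h gamma ->
    exists s1 s2 s3 s4, [/\ s1 + d <= s2, s2 + d <= s3, s3 + d <= s4 &
      is_dispersion_roots F h gamma s1 s2 s3 s4].
Proof.
move=> g01 m0 mH delta0; case/andP: (g01) => g0 g1.
have H0 : 0 < H by apply: lt_le_trans mH.
(* B bounds F and, by [dispersion_root_lt], all the roots. *)
pose B := 2 + 2 * Num.sqrt H.
have B2 : 2 <= B by rewrite lerDl mulr_ge0 ?sqrtr_ge0.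
have B0 : 0 < B by lra.
pose L := 2 * B * (4 * B ^+ 2 + H) + (B ^+ 2 + 1) * (4 * B).
have L0 : 0 < L.
  by repeat first [done|apply: addr_gt0|apply: mulr_gt0|apply: exprn_gt0].
pose eps := delta / 2 * (gamma * Num.min m 1 / 2).
have eps0 : 0 < eps by rewrite /eps !mulr_gt0// ?invr_gt0// lt_min m0 ltr01.
have gm0 : 0 < gamma * m by rewrite mulr_gt0.
pose d := Num.min (gamma * m / L) (eps / L).
have d0 : 0 < d by rewrite lt_min !divr_gt0.
exists d => // h F /andP[mh hH] F0 FZ.
have h0 : 0 < h by apply: lt_le_trans mh.
have gmh : gamma * m <= gamma * h by rewrite ler_pM2l.
pose F' := Num.sqrt (F ^+ 2 + delta / 2).
have F'2 : F' ^+ 2 = F ^+ 2 + delta / 2.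
  by rewrite sqr_sqrtr// addr_ge0 ?sqr_ge0// divr_ge0// ltW.
have F'0 : 0 <= F' by rewrite sqrtr_ge0.
have FF' : F < F' by rewrite -ltr_sqr ?nnegrE// F'2; lra.
have zc2 : F' ^+ 2 < zcrit h gamma by rewrite F'2; lra.
have F'1 := subcritical_le h0 g01 F'0 (ltW zc2).
have [s [ps s1 sF]] : exists s, [/\ dispersion F' h gamma s = 0, s ^+ 2 < 1
    & (s - F') ^+ 2 < h].
  apply: dispersion_inner_root => //; rewrite ?F'0//.
  by apply: q_gt0 => //; rewrite sqr_ge0.
have [s0 [s01 s0F ps0]] := dispersion_shrink F0 FF' h0 g01 ps s1 sF.
have {}ps0 : eps <= dispersion F h gamma s0.
  apply: le_trans ps0; rewrite F'2 /eps addrAC subrr add0r ler_wpM2l//.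
    by rewrite divr_ge0// ltW.
  rewrite ler_wpM2r// ler_wpM2l// ?(ltW g0)//.
  by rewrite le_min !ge_min lexx mh orbT.
have FB : F <= 1 + Num.sqrt h by lra.
have hHr : Num.sqrt h <= Num.sqrt H by rewrite ler_sqrt ?hH// ltW.
have BF : 1 + F + Num.sqrt h <= B by rewrite /B; lra.
have r0 : 0 < Num.sqrt h by rewrite sqrtr_gt0.
have rE := sqr_sqrtr (ltW h0).
have Lip x y : `|x| <= B -> `|y| <= B ->
    `|dispersion F h gamma x - dispersion F h gamma y| <= L * `|x - y|.
  move=> xB yB; apply: dispersion_lipschitz => //; rewrite ger0_norm ?(ltW h0)//.
  lra.
have rB x : dispersion F h gamma x = 0 -> `|x| <= B.
  by move=> /(dispersion_root_lt F0 h0 g1)/ltW xB; apply: le_trans BF.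
have [s_1 [s_4 [s11 s41 ps_1 ps_4]]] := dispersion_outer_roots F0 h0 g01.
have [s0l s0r] : -1 < s0 /\ s0 < 1 by apply: sqr_lt_itv; rewrite ?expr1n.
have [s0l' s0r'] : F - Num.sqrt h < s0 /\ s0 < F + Num.sqrt h.
  have [] := @sqr_lt_itv _ (s0 - F) (Num.sqrt h); rewrite ?rE ?(ltW r0)//.
  by clear; lra.
have left_ a : a < s0 -> `|a| <= B -> dispersion F h gamma a = - (gamma * h) ->
    s_1 < a -> exists s2, [/\ s2 < s0, dispersion F h gamma s2 = 0 & s_1 + d <= s2].
  move=> as0 aB pa s1a.
  have [|s2 [as2 s2s0 ps2]] := dispersion_ivt (ltW as0) (h:=h) (F:=F) (gamma:=gamma).
    by rewrite pa nmulr_rlt0 ?oppr_lt0 ?mulr_gt0// (lt_le_trans eps0).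
  exists s2; split => //.
  have := Lip _ _ (rB _ ps2) aB.
  rewrite ps2 pa sub0r opprK (gtr0_norm (mulr_gt0 g0 h0)) gtr0_norm ?subr_gt0//.
  move=> H1.
  have : d <= s2 - a.
    by rewrite (@le_trans _ _ (gamma * m / L)) ?ge_min ?lexx// ler_pdivrMr//
      [leRHS]mulrC (le_trans gmh).
  lra.
have [s2 [s2s0 ps2 s12]] : exists s2, [/\ s2 < s0,
    dispersion F h gamma s2 = 0 & s_1 + d <= s2].
  have [cF|cF] := leP (F - Num.sqrt h) (-1).
    apply: (left_ (-1)) => //; first by rewrite normrN1; lra.
    by rewrite /dispersion; ring.
  apply: (left_ (F - Num.sqrt h)) => //.
  - by rewrite ler_norml; lra.
  - by rewrite /dispersion -{3}rE; ring.
  - lra.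
have right_ a : s0 < a -> `|a| <= B -> dispersion F h gamma a = - (gamma * h) ->
    a < s_4 -> exists s3, [/\ s0 < s3, dispersion F h gamma s3 = 0 & s3 + d <= s_4].
  move=> as0 aB pa s1a.
  have [|s3 [s0s3 s3a ps3]] := dispersion_ivt (ltW as0) (h:=h) (F:=F) (gamma:=gamma).
    by rewrite pa pmulr_rlt0 ?oppr_lt0 ?mulr_gt0// (lt_le_trans eps0).
  exists s3; split => //.
  have := Lip _ _ (rB _ ps3) aB.
  rewrite ps3 pa sub0r opprK (gtr0_norm (mulr_gt0 g0 h0)) distrC
    gtr0_norm ?subr_gt0//.
  move=> H1.
  have : d <= a - s3.
    by rewrite (@le_trans _ _ (gamma * m / L)) ?ge_min ?lexx// ler_pdivrMr//
      [leRHS]mulrC (le_trans gmh).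
  lra.
have r4 := dispersion_right_root FB h0 g0 s41 ps_4.
have [s3 [s0s3 ps3 s34]] : exists s3, [/\ s0 < s3,
    dispersion F h gamma s3 = 0 & s3 + d <= s_4].
  have [cF|cF] := leP 1 (F + Num.sqrt h).
    apply: (right_ 1) => //; first by rewrite normr1; lra.
    by rewrite /dispersion; ring.
  apply: (right_ (F + Num.sqrt h)) => //.
  - by rewrite ler_norml; lra.
  - by rewrite /dispersion -{3}rE; ring.
have s0B : `|s0| <= B by rewrite ler_norml; lra.
have dL : d <= eps / L by rewrite /d ge_min lexx orbT.
have s23 : s2 + d <= s3.
  have := Lip _ _ (rB _ ps3) s0B.
  rewrite ps3 sub0r normrN (gtr0_norm (lt_le_trans eps0 ps0)).
  rewrite gtr0_norm ?subr_gt0// => H1.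
  have : eps / L <= s3 - s0.
    by rewrite ler_pdivrMr// [leRHS]mulrC (le_trans ps0).
  lra.
exists s_1, s2, s3, s_4; split => //.
exact: dispersion_roots_of_increasing d0 s12 s23 s34 ps_1 ps2 ps3 ps_4.
Qed.

Lemma uniform_gaps gamma m H delta : 0 < gamma < 1 -> 0 < m -> m <= H ->
  0 < delta ->
  exists2 d, 0 < d & forall h F, m <= h <= H ->
    F ^+ 2 + delta <= zcrit h gamma ->
    exists s1 s2 s3 s4, [/\ s1 + d <= s2, s2 + d <= s3, s3 + d <= s4 &
      is_dispersion_roots F h gamma s1 s2 s3 s4].
Proof.
move=> g01 m0 mH delta0.
have [d d0 gaps] := uniform_gaps_ge0 g01 m0 mH delta0.
exists d => // h F hm FZ.
have [F0|F0] := leP 0 F; first exact: gaps.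
have [||s1 [s2 [s3 [s4 [s12 s23 s34 ss]]]]] := gaps h (- F) hm.
- by rewrite oppr_ge0 ltW.
- by rewrite sqrrN.
exists (- s4), (- s3), (- s2), (- s1); split; try lra.
exact: is_dispersion_roots_opp.
Qed.

Lemma four_roots_of_lt_zcrit F h gamma : 0 < h -> 0 < gamma < 1 -> 0 <= F ->
  F ^+ 2 < zcrit h gamma ->
  exists s1 s2 s3 s4, [/\ s1 != s2, s1 != s3, s1 != s4, s2 != s3 & s2 != s4] /\
   s3 != s4 /\ is_dispersion_roots F h gamma s1 s2 s3 s4.
Proof.
move=> h0 g01 F0 Fz.
have [|x [y [s [t [[x1 y1 xs xt] [ys yt st ss]]]]]] :=
    dispersion_four_roots F0 h0 g01.
  by apply: q_gt0 => //; rewrite sqr_ge0.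
exists x, s, t, y; split; [split|split] => //; rewrite ?(eq_sym _ y)//.
  by rewrite gt_eqF//; lra.
by rewrite lt_eqF.
Qed.

Lemma discriminant_roots F h gamma s1 s2 s3 s4 :
  is_dispersion_roots F h gamma s1 s2 s3 s4 ->
  16 * h * q h gamma (F ^+ 2) =
  ((s1 - s2) * (s1 - s3) * (s1 - s4) * (s2 - s3) * (s2 - s4) * (s3 - s4)) ^+ 2.
Proof.
move=> [e1 e2 e3 e4].
rewrite (@discriminant_dispersion _ F h gamma s1 s4 (- (s2 + s3)) (s2 * s3)).
- by ring.
- by lra.
- by rewrite -e2; ring.
- by lra.
- by rewrite -e4; ring.
Qed.

(** [q] vanishes at [zcrit] and is Lipschitz, so a lower bound for q(F^2) is a
    lower bound for zcrit - F^2. If [Fr] itself were not subcritical, some F below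
    it would have F^2 within delta / 2 of zcrit, which the same bound forbids. *)
Lemma zcrit_margin gamma (H d : R) : 0 < gamma < 1 -> 0 < H -> 0 < d ->
  exists2 delta, 0 < delta & forall h Fr, 0 < h <= H -> 0 <= Fr ->
    (forall F, 0 <= F <= Fr -> F ^+ 2 < zcrit h gamma ->
       d <= 16 * h * q h gamma (F ^+ 2)) ->
    Fr ^+ 2 + delta <= zcrit h gamma.
Proof.
move=> g01 H0 d0.
have [L L0 Lip] := q_lipschitz (ltW H0) (sqr_ge0 (1 + Num.sqrt H)).
pose delta := d / (16 * H * L).
have delta0 : 0 < delta by rewrite divr_gt0// !mulr_gt0.
exists delta => // h Fr /andP[h0 hH] Fr0 hyp.
set Z := zcrit h gamma in hyp *.
have Z0 : 0 < Z by apply: zcrit_gt0.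
have ZH : Z <= (1 + Num.sqrt H) ^+ 2.
  apply: le_trans (zcrit_le h0 g01) _.
  by rewrite ler_sqr ?nnegrE ?addr_ge0 ?sqrtr_ge0// lerD2l ler_wsqrtr.
have gap F : 0 <= F <= Fr -> F ^+ 2 < Z -> F ^+ 2 + delta <= Z.
  move=> FFr FZ; have := hyp _ FFr FZ.
  have := Lip h gamma (F ^+ 2) Z g01.
  rewrite h0 hH sqr_ge0 (ltW Z0) ZH (le_trans (ltW FZ) ZH) => /(_ erefl erefl erefl).
  have ZF : 0 < Z - F ^+ 2 by rewrite subr_gt0.
  rewrite q_zcrit// subr0 (distrC (F ^+ 2)) (gtr0_norm ZF) => qL dq.
  suff : delta <= Z - F ^+ 2 by lra.
  rewrite ler_pdivrMr ?mulr_gt0// (le_trans dq)//.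
  have q0 := le_trans (ler_norm _) qL.
  rewrite (_ : (Z - F ^+ 2) * (16 * H * L) = 16 * H * (L * (Z - F ^+ 2))); last by ring.
  rewrite -!mulrA ler_pM2l//.
  apply: (@le_trans _ _ (h * (L * (Z - F ^+ 2)))); first by rewrite ler_pM2l.
  by rewrite ler_wpM2r// mulr_ge0 ?(ltW L0)// subr_ge0 ltW.
have [FZ|FZ] := ltP (Fr ^+ 2) Z; first by apply: gap => //; rewrite Fr0 lexx.
pose w := Num.max 0 (Z - delta / 2).
have w0 : 0 <= w by rewrite le_max lexx.
have wZ : w < Z by rewrite gt_max Z0; lra.
have := gap (Num.sqrt w).
rewrite sqrtr_ge0/= -ler_sqr ?nnegrE ?sqrtr_ge0// sqr_sqrtr//.
rewrite (le_trans (ltW wZ) FZ) => /(_ isT wZ).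
have : Z - delta / 2 <= w by rewrite le_max lexx orbT.
lra.
Qed.

End Gaps.

(** * Entrywise norms and complex sequences *)

Section Norm1.
Local Open Scope complex_scope.
Context {R : realType}.
Implicit Types (x y : R[i]).
Local Notation Re := (@complex.Re R).
Local Notation Im := (@complex.Im R).

Lemma normc_ge0 x : 0 <= normc x.
Proof. by case: x => a b; exact: sqrtr_ge0. Qed.

Lemma normcD x y : normc (x + y) <= normc x + normc y.
Proof. exact: le_normcD. Qed.

Lemma normc_real (a : R) : normc a%:C = `|a|.
Proof. by rewrite /= expr0n/= addr0 sqrtr_sqr. Qed.

Lemma normRe_le x : `|Re x| <= normc x.
Proof. by case: x => a b /=; rewrite -sqrtr_sqr ler_wsqrtr// lerDl sqr_ge0. Qed.

Lemma normIm_le x : `|Im x| <= normc x.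
Proof. by case: x => a b /=; rewrite -sqrtr_sqr ler_wsqrtr// lerDr sqr_ge0. Qed.

Lemma normc_le_ReIm x : normc x <= `|Re x| + `|Im x|.
Proof.
case: x => a b /=; rewrite -ler_sqr ?nnegrE ?sqrtr_ge0 ?addr_ge0//.
rewrite sqr_sqrtr ?addr_ge0 ?sqr_ge0// sqrrD !real_normK ?num_real//.
by rewrite lerD2r lerDl mulrn_wge0// mulr_ge0.
Qed.

(** Only boundedness matters here, and this norm makes the triangle inequality
    and submultiplicativity elementary. *)
Definition norm1 {m n} (M : 'M[R[i]]_(m, n)) : R := \sum_i \sum_j normc (M i j).

Lemma norm1_ge0 m n (M : 'M[R[i]]_(m, n)) : 0 <= norm1 M.
Proof. by do 2![apply: sumr_ge0 => ? _]; exact: normc_ge0. Qed.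

Lemma norm1D m n (M N : 'M[R[i]]_(m, n)) : norm1 (M + N) <= norm1 M + norm1 N.
Proof.
rewrite /norm1 -big_split ler_sum// => i _.
by rewrite -big_split ler_sum// => j _; rewrite mxE normcD.
Qed.

Lemma norm1Z m n a (M : 'M[R[i]]_(m, n)) : norm1 (a *: M) = normc a * norm1 M.
Proof.
rewrite /norm1 big_distrr/=; apply: eq_bigr => i _.
by rewrite big_distrr/=; apply: eq_bigr => j _; rewrite mxE normcM.
Qed.

Lemma norm1N m n (M : 'M[R[i]]_(m, n)) : norm1 (- M) = norm1 M.
Proof. by rewrite -scaleN1r norm1Z normcN normc1 mul1r. Qed.

Lemma norm1B m n (M N : 'M[R[i]]_(m, n)) : norm1 (M - N) <= norm1 M + norm1 N.
Proof. by rewrite (le_trans (norm1D _ _))// norm1N. Qed.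

Lemma normc_sum (I : Type) (r : seq I) (P : pred I) (F : I -> R[i]) :
  normc (\sum_(i <- r | P i) F i) <= \sum_(i <- r | P i) normc (F i).
Proof.
elim/big_ind2 : _ => //; first by rewrite normc0.
by move=> a b c d ab cd; rewrite (le_trans (normcD _ _))// lerD.
Qed.

Lemma row_le_norm1 m n (M : 'M[R[i]]_(m, n)) i :
  \sum_j normc (M i j) <= norm1 M.
Proof.
rewrite /norm1 (bigD1 i)//= lerDl; apply: sumr_ge0 => ? _.
by apply: sumr_ge0 => ? _; exact: normc_ge0.
Qed.

Lemma normc_le_norm1 m n (M : 'M[R[i]]_(m, n)) i j : normc (M i j) <= norm1 M.
Proof.
apply: le_trans (row_le_norm1 M i).
by rewrite (bigD1 j)//= lerDl; apply: sumr_ge0 => ? _; exact: normc_ge0.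
Qed.

Lemma normc_mulmx_le m n p (M : 'M[R[i]]_(m, n)) (N : 'M[R[i]]_(n, p)) i j (b : R) :
  (forall k, normc (N k j) <= b) -> normc ((M *m N) i j) <= norm1 M * b.
Proof.
case: n M N => [|n] M N Nb.
  by rewrite mxE big_ord0 normc0 /norm1 big1 ?mul0r// => l _; rewrite big_ord0.
have b0 := le_trans (normc_ge0 _) (Nb ord0).
rewrite mxE (le_trans (normc_sum _ _ _))//.
apply: le_trans (ler_wpM2r b0 (row_le_norm1 M i)).
rewrite big_distrl/= ler_sum// => l _; rewrite normcM.
by rewrite ler_wpM2l ?normc_ge0.
Qed.

Lemma norm1M m n p (M : 'M[R[i]]_(m, n)) (N : 'M[R[i]]_(n, p)) :
  norm1 (M *m N) <= norm1 M * norm1 N.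
Proof.
rewrite {1 2}/norm1 big_distrl/= ler_sum// => i _.
apply: (@le_trans _ _ (\sum_j \sum_k normc (M i k) * normc (N k j))).
  rewrite ler_sum// => j _; rewrite mxE (le_trans (normc_sum _ _ _))//.
  by rewrite ler_sum// => k _; rewrite normcM.
rewrite exchange_big/= big_distrl/= ler_sum// => k _.
by rewrite -big_distrr/= ler_wpM2l ?normc_ge0 ?row_le_norm1.
Qed.

(** Entrywise, because the norm of the identity matrix is its dimension, so that
    [norm1 (M ^+ k) <= norm1 M ^+ k] fails at k = 0. *)
Lemma normc_mxpow_le n (M : 'M[R[i]]_n) (K : R) k i j : norm1 M <= K ->
  normc ((M ^+ k) i j) <= K ^+ k.
Proof.
move=> MK; have K0 := le_trans (norm1_ge0 M) MK.
elim: k i => [|k IH] i.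
  rewrite !expr0 mxE; case: eqP => _; first by rewrite mulr1n normc1.
  by rewrite mulr0n normc0 ler01.
rewrite !exprS -mulmxE (le_trans (normc_mulmx_le _ _ IH))//.
by rewrite ler_wpM2r// exprn_ge0.
Qed.

(** The matrix form of the mean value bound for the k-th power, from
    M^(k+1) - N^(k+1) = M (M^k - N^k) + (M - N) N^k. *)
Lemma normc_mxpowB_le n (M N : 'M[R[i]]_n) (K : R) k i j :
  norm1 M <= K -> norm1 N <= K ->
  normc ((M ^+ k - N ^+ k) i j) <= norm1 (M - N) * (k%:R * K ^+ k.-1).
Proof.
move=> MK NK; have K0 := le_trans (norm1_ge0 M) MK.
elim: k i => [|k IH] i; first by rewrite !expr0 subrr mxE normc0 mul0r mulr0.
have -> : M ^+ k.+1 - N ^+ k.+1 = M *m (M ^+ k - N ^+ k) + (M - N) *m N ^+ k.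
  by rewrite mulmxBr mulmxBl !mulmxE -!exprS addrA subrK.
rewrite mxE (le_trans (normcD _ _))//.
have D0 := norm1_ge0 (M - N).
have A := normc_mulmx_le M i IH.
have B := @normc_mulmx_le _ _ _ (M - N) (N ^+ k) i j (K ^+ k)
  (fun l => normc_mxpow_le k l j NK).
apply: le_trans (lerD A B) _.
rewrite -natr1 mulrDl mul1r mulrDr lerD2r/= mulrCA ler_wpM2l//.
case: k {IH A B} => [|k]; first by rewrite !mul0r mulr0.
by rewrite mulrCA ler_wpM2l ?ler0n//= exprS ler_wpM2r// exprn_ge0.
Qed.

Lemma Re_add x y : Re (x + y) = Re x + Re y. Proof. by case: x; case: y. Qed.
Lemma Im_add x y : Im (x + y) = Im x + Im y. Proof. by case: x; case: y. Qed.
Lemma Re_realM (a : R) x : Re (a%:C * x) = a * Re x.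
Proof. by case: x => b c /=; rewrite mul0r subr0. Qed.
Lemma Im_realM (a : R) x : Im (a%:C * x) = a * Im x.
Proof. by case: x => b c /=; rewrite mul0r addr0. Qed.

Lemma Re_sum (I : Type) (r : seq I) (P : pred I) (F : I -> R[i]) :
  Re (\sum_(i <- r | P i) F i) = \sum_(i <- r | P i) Re (F i).
Proof. exact: (big_morph Re Re_add). Qed.
Lemma Im_sum (I : Type) (r : seq I) (P : pred I) (F : I -> R[i]) :
  Im (\sum_(i <- r | P i) F i) = \sum_(i <- r | P i) Im (F i).
Proof. exact: (big_morph Im Im_add). Qed.
Lemma Re_mul x y : Re (x * y) = Re x * Re y - Im x * Im y.
Proof. by case: x; case: y. Qed.
Lemma Im_mul x y : Im (x * y) = Re x * Im y + Im x * Re y.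
Proof. by case: x; case: y. Qed.

(** Coordinatewise convergence of complex sequences, the form in which the
    matrix exponential is defined. *)
Definition ccvg (u : nat -> R[i]) (l : R[i]) : Prop :=
  (Re (u k) @[k --> \oo] --> Re l) /\ (Im (u k) @[k --> \oo] --> Im l).

Lemma ccvg_unique u l l' : ccvg u l -> ccvg u l' -> l = l'.
Proof.
move=> [rl il] [rl' il']; apply/eqP; rewrite eq_complex.
by rewrite (cvg_unique _ rl rl')// (cvg_unique _ il il')// !eqxx.
Qed.

Lemma ccvgD u v l m : ccvg u l -> ccvg v m -> ccvg (fun k => u k + v k) (l + m).
Proof.
move=> [rl il] [rm im]; split; rewrite ?Re_add ?Im_add.
- by under eq_fun do rewrite Re_add; exact: cvgD.
- by under eq_fun do rewrite Im_add; exact: cvgD.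
Qed.

Lemma ccvg_cst l : ccvg (fun=> l) l.
Proof. by split; exact: cvg_cst. Qed.

Lemma ccvgM u v (l m : R[i]) : ccvg u l -> ccvg v m ->
  ccvg (fun k => u k * v k) (l * m).
Proof.
move=> [rl il] [rm im]; split; rewrite ?Re_mul ?Im_mul.
- by under eq_fun do rewrite Re_mul; apply: cvgB; apply: cvgM.
- by under eq_fun do rewrite Im_mul; apply: cvgD; apply: cvgM.
Qed.

Lemma ccvgMr u l a : ccvg u l -> ccvg (fun k => u k * a) (l * a).
Proof. by move=> ul; apply: ccvgM => //; exact: ccvg_cst. Qed.

Lemma ccvg_sum (I : Type) (r : seq I) (u : I -> nat -> R[i]) (l : I -> R[i]) :
  (forall i, ccvg (u i) (l i)) ->
  ccvg (fun k => \sum_(i <- r) u i k) (\sum_(i <- r) l i).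
Proof.
move=> ul; elim: r => [|i r IH].
  by rewrite big_nil; under eq_fun do rewrite big_nil; exact: ccvg_cst.
rewrite big_cons; under eq_fun do rewrite big_cons.
exact: ccvgD.
Qed.

Lemma normc_ccvg_le u l (b : R) : ccvg u l ->
  (forall k, normc (u k) <= b) -> normc l <= b *+ 2.
Proof.
move=> [rl il] ub; rewrite (le_trans (normc_le_ReIm _))// mulr2n lerD//.
- apply: (@cvgr_to_le _ \oo _ _ (fun k => `|Re (u k)|)); first exact: cvg_norm.
  by near=> k; rewrite (le_trans (normRe_le _)).
- apply: (@cvgr_to_le _ \oo _ _ (fun k => `|Im (u k)|)); first exact: cvg_norm.
  by near=> k; rewrite (le_trans (normIm_le _)).
Unshelve. all: by end_near. Qed.

End Norm1.

(** * The matrix exponential *)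

Section Exponential.
Local Open Scope complex_scope.
Context {R : realType}.
Implicit Types (x y : R[i]).
Local Notation Re := (@complex.Re R).
Local Notation Im := (@complex.Im R).

Lemma invfactC k : ((k`!%:R)^-1 : R[i]) = ((k`!%:R)^-1 : R)%:C.
Proof. by rewrite fmorphV rmorph_nat. Qed.

Lemma normc_invfactM k x : normc ((k`!%:R)^-1 * x) = (k`!%:R)^-1 * normc x.
Proof. by rewrite normcM invfactC normc_real ger0_norm// invr_ge0 ler0n. Qed.

Lemma cvg_dominated_series (u : nat -> R) (K : R) : 0 <= K ->
  (forall k, `|u k| <= (k`!%:R)^-1 * K ^+ k) ->
  cvgn (fun N => \sum_(k < N) u k).
Proof.
move=> K0 uK.
have -> : (fun N => \sum_(k < N) u k) = series u.
  by apply/funext => N; rewrite /series/= big_mkord.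
apply: normed_cvg; apply: series_le_cvg (is_cvg_series_exp_coeff K) => k /=.
- exact: normr_ge0.
- exact: exp_coeff_ge0.
- by rewrite /exp_coeff/= mulrC.
Qed.

Lemma expmx_partialE n (M : 'M[R[i]]_n) N i j :
  expmx_partial M N i j = \sum_(k < N) (k`!%:R)^-1 * (M ^+ k) i j.
Proof.
by rewrite /expmx_partial summxE; apply: eq_bigr => k _; rewrite mxE.
Qed.

Lemma expmx_ccvg n (M : 'M[R[i]]_n) i j :
  ccvg (fun N => expmx_partial M N i j) (expmx M i j).
Proof.
have bnd k : normc ((k`!%:R)^-1 * (M ^+ k) i j) <= (k`!%:R)^-1 * norm1 M ^+ k.
  rewrite normc_invfactM ler_wpM2l ?invr_ge0 ?ler0n//.
  exact: normc_mxpow_le.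
split; rewrite mxE /=.
- have -> : (fun N => Re (expmx_partial M N i j)) =
      (fun N => \sum_(k < N) Re ((k`!%:R)^-1 * (M ^+ k) i j)).
    by apply/funext => N; rewrite expmx_partialE Re_sum.
  apply: (@cvg_dominated_series (fun k => Re ((k`!%:R)^-1 * (M ^+ k) i j))
    (norm1 M)); first exact: norm1_ge0.
  by move=> k; apply: le_trans (normRe_le _) (bnd k).
- have -> : (fun N => Im (expmx_partial M N i j)) =
      (fun N => \sum_(k < N) Im ((k`!%:R)^-1 * (M ^+ k) i j)).
    by apply/funext => N; rewrite expmx_partialE Im_sum.
  apply: (@cvg_dominated_series (fun k => Im ((k`!%:R)^-1 * (M ^+ k) i j))
    (norm1 M)); first exact: norm1_ge0.
  by move=> k; apply: le_trans (normIm_le _) (bnd k).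
Qed.

Lemma expmx_mulmx_ccvg n p (M : 'M[R[i]]_n) (z : 'M[R[i]]_(n, p)) i j :
  ccvg (fun N => (expmx_partial M N *m z) i j) ((expmx M *m z) i j).
Proof.
rewrite mxE; under eq_fun do rewrite mxE.
by apply: ccvg_sum => k; apply: ccvgMr; exact: expmx_ccvg.
Qed.

Lemma expmx_partial_mulmxE n p (M : 'M[R[i]]_n) (z : 'M[R[i]]_(n, p)) N i j :
  (expmx_partial M N *m z) i j =
  \sum_(k < N) (k`!%:R)^-1 * (M ^+ k *m z) i j.
Proof.
rewrite /expmx_partial mulmx_suml summxE; apply: eq_bigr => k _.
by rewrite -scalemxAl mxE.
Qed.

Lemma expNiM (x : R) k : (- ('i * x%:C)) ^+ k =
  ((~~ odd k)%:R * (-1) ^+ k./2 * x ^+ k)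
    -i* ((odd k)%:R * (-1) ^+ k.-1./2 * x ^+ k) :> R[i].
Proof.
elim/ltn_ind: k => -[|[|k]] IH.
- by rewrite !expr0 /= !mulr1 oppr0.
- rewrite !expr1 /=; apply/eqP; rewrite eq_complex /=.
  by apply/andP; split; apply/eqP; ring.
- have -> : (- ('i * x%:C)) ^+ k.+2 = (- x ^+ 2)%:C * (- ('i * x%:C)) ^+ k.
    rewrite -addn2 exprD mulrC; congr (_ * _).
    rewrite sqrrN exprMn sqr_i -rmorphXn mulN1r -rmorphN; congr (_%:C).
  rewrite IH//= !negbK; apply/eqP; rewrite eq_complex /= !mul0r subr0 addr0.
  case: k {IH} => [|k] /=.
    by apply/andP; split; apply/eqP; ring.
  by rewrite ?negbK !exprS; apply/andP; split; apply/eqP; ring.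
Qed.

Lemma exp_series_imag (x : R) :
  ccvg (fun N => \sum_(k < N) (k`!%:R)^-1 * (- ('i * x%:C)) ^+ k)
       (cos x -i* sin x).
Proof.
split => /=.
- have -> : (fun N => Re (\sum_(k < N) (k`!%:R)^-1 * (- ('i * x%:C)) ^+ k)) =
      series (cos_coeff x).
    apply/funext => N; rewrite Re_sum /series/= big_mkord.
    by apply: eq_bigr => k _; rewrite invfactC Re_realM expNiM cos_coeffE/=; ring.
  by rewrite cos.unlock; exact: is_cvg_series_cos_coeff.
- have -> : (fun N => Im (\sum_(k < N) (k`!%:R)^-1 * (- ('i * x%:C)) ^+ k)) =
      (fun N => - series (sin_coeff x) N).
    apply/funext => N; rewrite Im_sum /series/= big_mkord -sumrN.
    by apply: eq_bigr => k _; rewrite invfactC Im_realM expNiM sin_coeffE/=; ring.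
  by apply: cvgN; rewrite sin.unlock; exact: is_cvg_series_sin_coeff.
Qed.

(** On an eigenvector the exponential series of M is the scalar one, and for the
    eigenvalue - i x its real and imaginary parts are the series of cos x and
    - sin x. *)
Lemma expmx_eigen_imag n (M : 'M[R[i]]_n) (z : 'cV[R[i]]_n) (x : R) :
  M *m z = - ('i * x%:C) *: z -> expmx M *m z = (cos x -i* sin x) *: z.
Proof.
move=> Mz; apply/matrixP => i j.
apply: ccvg_unique (expmx_mulmx_ccvg M z i j) _.
rewrite mxE; under eq_fun do rewrite expmx_partial_mulmxE.
have Mk k : M ^+ k *m z = (- ('i * x%:C)) ^+ k *: z.
  elim: k => [|k IH]; first by rewrite !expr0 mul1mx scale1r.
  by rewrite exprSr -mulmxE -mulmxA Mz -scalemxAr IH scalerA -exprS.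
under eq_fun => N.
  under eq_bigr do rewrite Mk mxE mulrA.
  rewrite -big_distrl /=. over.
by apply: ccvgMr; exact: exp_series_imag.
Qed.

Lemma normc_phase (x : R) : normc (cos x -i* sin x) = 1.
Proof. by rewrite /= sqrrN cos2Dsin2 sqrtr1. Qed.

(** When M^2 z is a nonnegative multiple of z, all terms of the imaginary part
    of the i-th component of exp(M) z have the same sign, and the linear one is
    a. *)
Lemma expmx_growth n (M : 'M[R[i]]_n) (z w : 'cV[R[i]]_n) (nu a : R) i :
  M *m z = w -> M *m w = nu%:C *: z -> 0 <= nu ->
  z i 0 = 0 -> w i 0 = 0 +i* a -> 0 <= a ->
  a <= normc ((expmx M *m z) i 0).
Proof.
move=> Mz Mw nu0 zi wi a0.
have Mk k : Im ((M ^+ k *m z) i 0) = (odd k)%:R * nu ^+ k./2 * a /\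
            Im ((M ^+ k *m w) i 0) = (~~ odd k)%:R * nu ^+ k./2 * a.
  have E b : Im ((nu%:C *: b : 'cV_n) i 0) = nu * Im (b i 0).
    by rewrite mxE Im_realM.
  elim: k => [|k [IHz IHw]].
    by rewrite !expr0 !mul1mx zi wi /= !mul0r !mul1r.
  split; rewrite exprSr -mulmxE -mulmxA.
    by rewrite Mz IHw /= uphalf_half; case: (odd k); rewrite /= ?mul0r.
  rewrite Mw -scalemxAr E IHz /= negbK uphalf_half.
  by case: (odd k); rewrite /= ?mul0r ?mulr0// exprS !mul1r mulrA.
apply: le_trans (normIm_le _).
apply: le_trans (ler_norm _).
have [_ +] := expmx_mulmx_ccvg M z i 0.
move=> /cvgr_to_ge; apply; near=> N.
have N2 : (1 < N)%N by near: N; exists 2.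
rewrite expmx_partial_mulmxE Im_sum (bigD1 (Ordinal N2))//=.
rewrite invfactC Im_realM (Mk 1%N).1 /= invr1 expr0 !mul1r lerDl.
apply: sumr_ge0 => k _; rewrite invfactC Im_realM (Mk k).1.
by rewrite !mulr_ge0 ?invr_ge0 ?ler0n// exprn_ge0.
Unshelve. all: by end_near. Qed.

(** The derivative of the exponential series is dominated by the real
    exponential of K; the factor 2 accounts for the real and imaginary parts. *)
Lemma expmx_lipschitz n (M N : 'M[R[i]]_n) (K : R) i j :
  norm1 M <= K -> norm1 N <= K ->
  normc ((expmx M - expmx N) i j) <= norm1 (M - N) * expR K *+ 2.
Proof.
move=> MK NK; have K0 := le_trans (norm1_ge0 M) MK.
have D0 := norm1_ge0 (M - N).
have -> : (expmx M - expmx N) i j = expmx M i j + expmx N i j * -1.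
  by rewrite [LHS]mxE [X in _ + X]mxE mulrN1.
apply: (@normc_ccvg_le _ (fun k => expmx_partial M k i j
                                   + expmx_partial N k i j * -1)).
  by apply: ccvgD; last apply: ccvgMr; exact: expmx_ccvg.
move=> k; rewrite mulrN1 !expmx_partialE -sumrB (le_trans (normc_sum _ _ _))//.
have S_le : \sum_(l < k) (l`!%:R)^-1 * (l%:R * K ^+ l.-1) <= expR K.
  case: k => [|k]; first by rewrite big_ord0 expR_ge0.
  rewrite big_ord_recl/= mul0r mulr0 add0r.
  have -> : \sum_(l < k) ((bump 0 l)`!%:R)^-1 * ((bump 0 l)%:R * K ^+ l) =
      series (exp_coeff K) k.
    rewrite /series/= big_mkord; apply: eq_bigr => l _.
    rewrite /exp_coeff/= /bump leq0n add1n factS natrM invfM.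
    by rewrite mulrA -[_ * l.+1%:R]mulrC !mulrA divff ?mul1r ?pnatr_eq0// mulrC.
  apply: nondecreasing_cvgn_le; last exact: is_cvg_series_exp_coeff.
  apply/nondecreasing_seqP => m; rewrite /series/= big_nat_recr//= lerDl.
  exact: exp_coeff_ge0.
apply: le_trans (ler_wpM2l D0 S_le).
rewrite big_distrr/= ler_sum// => l _.
rewrite -mulrBr normc_invfactM mulrCA ler_wpM2l ?invr_ge0 ?ler0n//.
by have := normc_mxpowB_le l i j MK NK; rewrite !mxE.
Qed.

Lemma expmx_continuous n (M : 'M[R[i]]_n) (e : R) : 0 < e ->
  exists2 d, 0 < d & forall N, norm1 (N - M) < d ->
    norm1 (expmx N - expmx M) < e.
Proof.
move=> e0; set K := norm1 M + 1.
have K0 : 0 <= K by rewrite addr_ge0// norm1_ge0.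
pose C := (n * n)%:R * (expR K *+ 2) + 1.
have C0 : 0 < C by rewrite ltr_wpDl// mulr_ge0 ?mulrn_wge0 ?expR_ge0.
exists (Num.min 1 (e / C)); first by rewrite lt_min ltr01 divr_gt0.
move=> N; rewrite lt_min => /andP[N1]; rewrite ltr_pdivlMr// => NC.
have NK : norm1 N <= K.
  by rewrite -[N](subrK M) (le_trans (norm1D _ _))// addrC lerD2l ltW.
apply: le_lt_trans NC.
apply: (@le_trans _ _ (\sum_(i < n) \sum_(j < n) norm1 (N - M) * expR K *+ 2)).
  rewrite ler_sum// => i _; rewrite ler_sum// => j _.
  by apply: expmx_lipschitz => //; rewrite lerDl.
rewrite !sumr_const !card_ord -!mulrnA -[leLHS]mulr_natl !natrM /C.
have := norm1_ge0 (N - M); rewrite natrM -[expR K *+ 2]mulr_natl; lra.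
Qed.

End Exponential.

(** * Exponential of a shifted matrix *)

Section Shift.
Local Open Scope complex_scope.
Context {R : realType}.
Implicit Types (x y : R[i]).
Local Notation Re := (@complex.Re R).
Local Notation Im := (@complex.Im R).

(** The Cauchy product of two partial sums: the triangle i + j < N, summed by
    diagonals, and the rest of the square. *)
Lemma sum_square_split (V : zmodType) (F : nat -> nat -> V) N :
  \sum_(i < N) \sum_(j < N) F i j =
  \sum_(k < N) \sum_(i < k.+1) F i (k - i)%N
  + \sum_(i < N) \sum_(j < N | (N <= i + j)%N) F i j.
Proof.
have -> : \sum_(k < N) \sum_(i < k.+1) F i (k - i)%N =
    \sum_(i < N) \sum_(j < N | ~~ (N <= i + j)%N) F i j.
  transitivity (\sum_(k < N) \sum_(i < N | (i <= k)%N) F i (k - i)%N).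
    apply: eq_bigr => k _.
    rewrite (big_ord_widen_cond N predT (fun i => F i (k - i)%N))//.
  rewrite (exchange_big_dep predT)//=; apply: eq_bigr => i _.
  rewrite -(big_mkord (fun k => (i <= k)%N) (fun k => F i (k - i)%N)).
  rewrite -(big_mkord (fun j => ~~ (N <= i + j)%N) (fun j => F i j)).
  rewrite (big_cat_nat (n := i)) ?(ltnW (ltn_ord i))//=.
  rewrite big_nat_cond big1 ?add0r; last first.
    by move=> k /andP[/andP[_ ki]]; rewrite leqNgt ki.
  rewrite [RHS](big_cat_nat (n := (N - i)%N)) ?leq_subr//=.
  rewrite [X in _ = _ + X]big_nat_cond [X in _ = _ + X]big1 ?addr0; last first.
    by move=> k /andP[/andP[]]; rewrite leq_subLR => ->.
  rewrite -{1}[nat_of_ord i]add0n big_addn big_nat_cond [RHS]big_nat_cond.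
  apply: eq_big => k; last by rewrite addnK.
  by rewrite leq_addl -ltnNge -ltn_subRL leq0n/=; case: ltnP.
rewrite -big_split/=; apply: eq_bigr => i _.
by rewrite [LHS](bigID (fun j : 'I_N => (N <= i + j)%N))/= addrC.
Qed.

Lemma ccvg0_le u (b : nat -> R) : (forall k, normc (u k) <= b k) ->
  b @ \oo --> 0 -> ccvg u 0.
Proof.
move=> ub b0; split.
- apply/norm_cvg0P; apply: (squeeze_cvgr _ (cvg_cst 0) b0).
  by near=> k; rewrite normr_ge0 (le_trans (normRe_le _)).
- apply/norm_cvg0P; apply: (squeeze_cvgr _ (cvg_cst 0) b0).
  by near=> k; rewrite normr_ge0 (le_trans (normIm_le _)).
Unshelve. all: by end_near. Qed.

Lemma binomial_fact (F : numFieldType) k i : (i <= k)%N ->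
  (k`!%:R)^-1 * 'C(k, i)%:R = (i`!%:R)^-1 * ((k - i)`!%:R)^-1 :> F.
Proof.
move=> ik; have fnz j : j`!%:R != 0 :> F by rewrite pnatr_eq0 -lt0n fact_gt0.
have c0 : 'C(k, i)%:R != 0 :> F by rewrite pnatr_eq0 -lt0n bin_gt0.
have -> : k`!%:R = 'C(k, i)%:R * (i`!%:R * (k - i)`!%:R) :> F.
  by rewrite -!natrM bin_fact.
by field; rewrite c0 !fnz.
Qed.

Lemma exp_partial_cauchy n (M : 'M[R[i]]_n) a N :
  (\sum_(k < N) (k`!%:R)^-1 * a ^+ k) *: expmx_partial M N =
  expmx_partial (a%:M + M) N +
  \sum_(i < N) \sum_(j < N | (N <= i + j)%N)
     ((i`!%:R)^-1 * a ^+ i * (j`!%:R)^-1) *: M ^+ j.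
Proof.
pose F i j := ((i`!%:R)^-1 * a ^+ i * (j`!%:R)^-1) *: M ^+ j.
transitivity (\sum_(i < N) \sum_(j < N) F i j).
  rewrite scaler_suml; apply: eq_bigr => i _.
  by rewrite scaler_sumr; apply: eq_bigr => j _; rewrite scalerA.
rewrite (sum_square_split F); congr (_ + _).
apply: eq_bigr => k _.
have cMa : GRing.comm M a%:M by exact: esym (comm_scalar_mx _ _).
rewrite addrC (GRing.exprDn_comm _ cMa) scaler_sumr.
apply: eq_bigr => i _.
have aX m : a%:M ^+ m = (a ^+ m)%:M :> 'M[R[i]]_n.
  by elim: m => [|m IH]; rewrite ?expr0// !exprS IH -mulmxE -scalar_mxM.
have ik : (i <= k)%N by rewrite -ltnS.
rewrite /F aX -mulmxE scalar_mxC mul_scalar_mx -[_ *+ 'C(k, i)]scaler_nat !scalerA.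
by rewrite mulrAC -(binomial_fact _ ik).
Qed.

(** The rest of the square in the Cauchy product is bounded by the same rest for
    the real series at |a| and [norm1 M], which tends to 0 by the addition formula
    of the real exponential. *)
Lemma expmx_shift n (M : 'M[R[i]]_n) a e :
  ccvg (fun N => \sum_(k < N) (k`!%:R)^-1 * a ^+ k) e ->
  expmx (a%:M + M) = e *: expmx M.
Proof.
move=> ae; apply/matrixP => i j; rewrite [RHS]mxE.
pose al := normc a; pose K := norm1 M.
have al0 : 0 <= al by exact: normc_ge0.
have K0 : 0 <= K by exact: norm1_ge0.
pose p (x : R) N : R := series (exp_coeff x) N.
have pE (t : R) N : p t N = \sum_(k < N) (k`!%:R)^-1 * t ^+ k.
  by rewrite /p /series/= big_mkord; apply: eq_bigr => k _; rewrite mulrC.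
have pc (t : R) : p t @ \oo --> expR t by exact: is_cvg_series_exp_coeff.
pose D N := \sum_(i < N) \sum_(j < N | (N <= i + j)%N)
     ((i`!%:R)^-1 * a ^+ i * (j`!%:R)^-1) *: M ^+ j.
pose b N := p al N * p K N - p (al + K) N.
have Db N : normc (D N i j) <= b N.
  have -> : b N = \sum_(i < N) \sum_(j < N | (N <= i + j)%N)
     (i`!%:R)^-1 * al ^+ i * ((j`!%:R)^-1 * K ^+ j).
    rewrite /b !pE; apply/eqP; rewrite subr_eq addrC; apply/eqP.
    pose F i j := (i`!%:R)^-1 * al ^+ i * ((j`!%:R)^-1 * K ^+ j).
    rewrite big_distrlr/= (sum_square_split F); congr (_ + _).
    apply: eq_bigr => k _; rewrite addrC exprDn big_distrr/=.
    apply: eq_bigr => l _; have lk : (l <= k)%N by rewrite -ltnS.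
    rewrite -[_ *+ 'C(k, l)]mulr_natl [RHS]mulrA binomial_fact// /F; ring.
  rewrite /D summxE (le_trans (normc_sum _ _ _))// ler_sum// => k _.
  rewrite summxE (le_trans (normc_sum _ _ _))// ler_sum// => l _.
  rewrite mxE -!mulrA normc_invfactM ler_wpM2l ?invr_ge0 ?ler0n//.
  rewrite normcM normc_invfactM.
  have -> : normc (a ^+ k) = al ^+ k.
    elim: (nat_of_ord k) => [|m IH]; first by rewrite !expr0 normc1.
    by rewrite !exprS normcM IH.
  rewrite ler_wpM2l ?exprn_ge0// ler_wpM2l ?invr_ge0 ?ler0n//.
  exact: normc_mxpow_le.
have b0 : b @ \oo --> 0.
  rewrite -(subrr (expR (al + K))) {1}expRD.
  by apply: cvgB; [apply: cvgM|]; exact: pc.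
have A := ccvgM ae (expmx_ccvg M i j).
apply: ccvg_unique (expmx_ccvg _ i j) _.
have -> : e * expmx M i j = e * expmx M i j + 0 * (-1).
  by rewrite mul0r addr0.
have -> : (fun N => expmx_partial (a%:M + M) N i j) =
   (fun N => (\sum_(k < N) (k`!%:R)^-1 * a ^+ k) * expmx_partial M N i j
      + D N i j * (-1)).
  apply/funext => N; have := exp_partial_cauchy M a N.
  move=> /matrixP/(_ i j); rewrite [LHS]mxE [in RHS]mxE => ->.
  by rewrite mulrN1 -/(D N) addrK.
by apply: ccvgD => //; apply: ccvgMr; exact: ccvg0_le Db b0.
Qed.

End Shift.

(** * The symbol in a fixed direction *)

Section Action.
Local Open Scope complex_scope.
Context {R : realType}.
Implicit Types (g gamma theta : R) (u : 'cV[R]_6).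

Definition mk6 (a b c d e f : R[i]) : 'cV[R[i]]_6 :=
  \col_i nth 0 [:: a; b; c; d; e; f] i.

Lemma mk6K (z : 'cV[R[i]]_6) : z =
  mk6 (z (inord 0) 0) (z (inord 1) 0) (z (inord 2) 0)
      (z (inord 3) 0) (z (inord 4) 0) (z (inord 5) 0).
Proof.
apply/matrixP => i j; rewrite mxE (ord1 j).
by case: i => [[|[|[|[|[|[|//]]]]]] i6] /=; congr (z _ _); apply/val_inj;
  rewrite /= inordK.
Qed.

Lemma mk6D a b c d e f a' b' c' d' e' f' :
  mk6 a b c d e f + mk6 a' b' c' d' e' f' =
  mk6 (a + a') (b + b') (c + c') (d + d') (e + e') (f + f').
Proof.
by apply/matrixP => i j; rewrite !mxE; case: i => [[|[|[|[|[|[|//]]]]]] i6].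
Qed.

Lemma mk6Z l a b c d e f :
  l *: mk6 a b c d e f = mk6 (l * a) (l * b) (l * c) (l * d) (l * e) (l * f).
Proof.
by apply/matrixP => i j; rewrite !mxE; case: i => [[|[|[|[|[|[|//]]]]]] i6].
Qed.

Lemma norm1_mk6 a b c d e f : norm1 (mk6 a b c d e f) =
  normc a + normc b + normc c + normc d + normc e + normc f.
Proof.
rewrite /norm1 !big_ord_recl !big_ord0 !mxE /= !addr0.
by rewrite !addrA.
Qed.

Definition complexA g gamma u theta : 'M[R[i]]_6 :=
  map_mx (real_complex R) (Atheta g gamma u theta).

Lemma complexA_mk6 g gamma u theta a b c d e f :
  let C := (cos theta)%:C in let S := (sin theta)%:C in
  let V1 := (cos theta * u1 u + sin theta * v1 u)%:C in
  let V2 := (cos theta * u2 u + sin theta * v2 u)%:C in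
  complexA g gamma u theta *m mk6 a b c d e f =
  mk6 (V1 * a + (h1 u)%:C * (C * c + S * e))
      (V2 * b + (h2 u)%:C * (C * d + S * f))
      (C * (g%:C * (a + b)) + V1 * c)
      (C * (g%:C * (gamma%:C * a + b)) + V2 * d)
      (S * (g%:C * (a + b)) + V1 * e)
      (S * (g%:C * (gamma%:C * a + b)) + V2 * f).
Proof.
move=> C S V1 V2.
have E (x y : R) : (cos theta * x + sin theta * y)%:C = C * x%:C + S * y%:C.
  by rewrite rmorphD !rmorphM.
apply/matrixP => i j; rewrite mxE !big_ord_recl big_ord0 addr0.
rewrite /V1 /V2.
case: i => [[|[|[|[|[|[|//]]]]]] i6];
  rewrite !mxE /= !E /= ?rmorphM; ring.
Qed.


(** The layer depths together with velocities parallel to the direction theta: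
    an invariant subspace of the symbol. *)
Definition along theta (a b c d : R[i]) : 'cV[R[i]]_6 :=
  mk6 a b ((cos theta)%:C * c) ((cos theta)%:C * d)
          ((sin theta)%:C * c) ((sin theta)%:C * d).

(** Velocities orthogonal to the direction theta: the symbol is diagonal on
    them. *)
Definition across theta (e f : R[i]) : 'cV[R[i]]_6 :=
  mk6 0 0 (- (sin theta)%:C * e) (- (sin theta)%:C * f)
          ((cos theta)%:C * e) ((cos theta)%:C * f).

Definition vel1 u theta : R := cos theta * u1 u + sin theta * v1 u.
Definition vel2 u theta : R := cos theta * u2 u + sin theta * v2 u.

Lemma cos2Dsin2C theta : (cos theta)%:C ^+ 2 + (sin theta)%:C ^+ 2 = 1 :> R[i].
Proof. by rewrite -!rmorphXn -rmorphD cos2Dsin2. Qed.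

Lemma complexA_along g gamma u theta a b c d :
  complexA g gamma u theta *m along theta a b c d =
  along theta ((vel1 u theta)%:C * a + (h1 u)%:C * c)
              ((vel2 u theta)%:C * b + (h2 u)%:C * d)
              (g%:C * (a + b) + (vel1 u theta)%:C * c)
              (g%:C * (gamma%:C * a + b) + (vel2 u theta)%:C * d).
Proof.
have K x : (cos theta)%:C * ((cos theta)%:C * x) +
           (sin theta)%:C * ((sin theta)%:C * x) = x.
  by rewrite !mulrA -mulrDl -!expr2 cos2Dsin2C mul1r.
rewrite /along complexA_mk6 -/(vel1 u theta) -/(vel2 u theta) !K.
by congr mk6; ring.
Qed.

Lemma complexA_across g gamma u theta e f :
  complexA g gamma u theta *m across theta e f =
  across theta ((vel1 u theta)%:C * e) ((vel2 u theta)%:C * f).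
Proof.
rewrite /across complexA_mk6 -/(vel1 u theta) -/(vel2 u theta).
by congr mk6; ring.
Qed.

Lemma along_acrossK theta (z : 'cV[R[i]]_6) :
  let C := (cos theta)%:C in let S := (sin theta)%:C in
  z = along theta (z (inord 0) 0) (z (inord 1) 0)
        (C * z (inord 2) 0 + S * z (inord 4) 0)
        (C * z (inord 3) 0 + S * z (inord 5) 0)
    + across theta (C * z (inord 4) 0 - S * z (inord 2) 0)
                   (C * z (inord 5) 0 - S * z (inord 3) 0).
Proof.
move=> C S; rewrite {1}(mk6K z) mk6D.
have E x : x = x * (C ^+ 2 + S ^+ 2) by rewrite cos2Dsin2C mulr1.
congr mk6; rewrite ?addr0//.
- by rewrite {1}(E (z (inord 2) 0)); ring.
- by rewrite {1}(E (z (inord 3) 0)); ring.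
- by rewrite {1}(E (z (inord 4) 0)); ring.
- by rewrite {1}(E (z (inord 5) 0)); ring.
Qed.

Lemma alongD theta a b c d a' b' c' d' :
  along theta a b c d + along theta a' b' c' d' =
  along theta (a + a') (b + b') (c + c') (d + d').
Proof. by rewrite /along mk6D !mulrDr. Qed.

Lemma alongZ theta l a b c d :
  l *: along theta a b c d = along theta (l * a) (l * b) (l * c) (l * d).
Proof. by rewrite /along mk6Z; congr mk6; ring. Qed.

Lemma alongN theta a b c d :
  - along theta a b c d = along theta (- a) (- b) (- c) (- d).
Proof. by rewrite -scaleN1r alongZ !mulN1r. Qed.

Lemma norm1_along theta a b c d : norm1 (along theta a b c d) =
  normc a + normc b + (`|cos theta| + `|sin theta|) * (normc c + normc d).
Proof. by rewrite norm1_mk6 !normcM !normc_real; ring. Qed.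

Lemma norm1_across theta e f : norm1 (across theta e f) =
  (`|cos theta| + `|sin theta|) * (normc e + normc f).
Proof.
by rewrite norm1_mk6 !normcM normcN normc0 !normc_real; ring.
Qed.

Lemma cos_sin_norm_le2 theta : `|cos theta| + `|sin theta| <= 2.
Proof.
rewrite (natrD _ 1 1) lerD//.
- by rewrite ler_norml cos_geN1 cos_le1.
- by rewrite ler_norml sin_geN1 sin_le1.
Qed.

Lemma cos_sin_norm_ge1 theta : 1 <= `|cos theta| + `|sin theta|.
Proof.
rewrite -ler_sqr ?nnegrE ?addr_ge0// expr1n -(cos2Dsin2 theta).
rewrite sqrrD !real_normK ?num_real// lerD2r lerDl mulrn_wge0// mulr_ge0//.
Qed.

Fixpoint annihilated n (A : 'M[R[i]]_n) (s : seq R[i]) (x : 'cV[R[i]]_n) : Prop :=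
  if s is l :: s' then annihilated A s' ((A - l%:M) *m x) else x = 0.

(** By induction on the number of eigenvalues: if l and m are two of them,
    (m - l) x = (A - l) x - (A - m) x, where the first term is annihilated without
    l and the second without m. This bounds E x without diagonalizing A. *)
Lemma spectral_bound n (A E : 'M[R[i]]_n) (kappa delta : R) l s x :
  0 <= kappa -> 0 < delta ->
  (forall m, m \in l :: s ->
     (forall y : 'cV_n, norm1 ((A - m%:M) *m y) <= kappa * norm1 y) /\
     (forall y : 'cV_n, A *m y = m *: y -> norm1 (E *m y) <= norm1 y)) ->
  pairwise (fun a b => delta <= normc (a - b)) (l :: s) ->
  annihilated A (l :: s) x ->
  norm1 (E *m x) <= (2 * kappa / delta) ^+ size s * norm1 x.
Proof.
move=> k0 d0; elim: s l x => [|m s IH] l x hyp sep.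
  move=> /= /eqP; rewrite mulmxBl subr_eq0 mul_scalar_mx => /eqP Ax.
  by rewrite expr0 mul1r; apply: (hyp l _).2 => //; rewrite inE eqxx.
move=> kx.
have [xl _] := hyp l (mem_head _ _).
have [xm _] : (forall y : 'cV_n, norm1 ((A - m%:M) *m y) <= kappa * norm1 y) /\
     (forall y : 'cV_n, A *m y = m *: y -> norm1 (E *m y) <= norm1 y).
  by apply: hyp; rewrite !inE eqxx orbT.
move: sep; rewrite /= => /andP[/andP[lm ls] /andP[ms ss]].
have B1 : norm1 (E *m ((A - l%:M) *m x)) <=
    (2 * kappa / delta) ^+ size s * norm1 ((A - l%:M) *m x).
  apply: (IH m) => //=; last by rewrite ms.
  by move=> a ain; apply: hyp; rewrite inE ain orbT.
have B2 : norm1 (E *m ((A - m%:M) *m x)) <=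
    (2 * kappa / delta) ^+ size s * norm1 ((A - m%:M) *m x).
  apply: (IH l) => /=; last 2 first.
  - by rewrite ls.
  - suff -> : (A - l%:M) *m ((A - m%:M) *m x) = (A - m%:M) *m ((A - l%:M) *m x).
      exact: kx.
    rewrite !mulmxA; congr (_ *m _).
    have -> : A - m%:M = (A - l%:M) + (l - m)%:M by rewrite raddfB addrA subrK.
    by move: (A - l%:M) => P; rewrite mulmxDr mulmxDl scalar_mxC.
  move=> a; rewrite inE => /predU1P[->|ain]; apply: hyp; rewrite !inE ?eqxx//.
  by rewrite ain !orbT.
have xE : (m - l) *: x = (A - l%:M) *m x - (A - m%:M) *m x.
  by rewrite !mulmxBl !mul_scalar_mx scalerBl opprB [RHS]addrC addrA subrK.
set T := 2 * kappa / delta in B1 B2 *.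
have T0 : 0 <= T ^+ size s by rewrite exprn_ge0// /T !mulr_ge0// invr_ge0 ltW.
have : delta * norm1 (E *m x) <= 2 * (T ^+ size s * (kappa * norm1 x)).
  apply: (@le_trans _ _ (norm1 ((m - l) *: (E *m x)))).
    by rewrite norm1Z -normcN opprB ler_wpM2r ?norm1_ge0.
  rewrite scalemxAr xE mulmxBr (le_trans (norm1B _ _))// mulr_natl mulr2n lerD//.
  - by rewrite (le_trans B1)// ler_wpM2l.
  - by rewrite (le_trans B2)// ler_wpM2l.
rewrite -ler_pdivlMl// => H; apply: le_trans H _.
by rewrite exprS /T le_eqVlt; apply/orP; left; apply/eqP; ring.
Qed.

End Action.

(** * Bounding the propagator *)

Section ReducedStep.
Context {K : comPzRingType}.
Implicit Types (x : K * K * K * K).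

(** The action of A - (V + L) on the components (a, b, c, d) of a vector carried
    by the direction theta, where V is the velocity of the first layer, U the
    difference of the velocities and a1, a2 the depths; it is stated over a ring
    for the sake of the polynomial identity that follows. *)
Definition reduced_step (g gamma a1 a2 U L : K) x : K * K * K * K :=
  let: (a, b, c, d) := x in
  (a1 * c - L * a, (U - L) * b + a2 * d, g * (a + b) - L * c,
   g * (gamma * a + b) + (U - L) * d).

(** Cayley-Hamilton for the reduced symbol: the hypotheses say that the L's are
    the roots of its characteristic polynomial
    (X^2 - g a1) ((X - U)^2 - g a2) - gamma g^2 a1 a2. *)
Lemma reduced_step_annihilated (g gamma a1 a2 U L1 L2 L3 L4 : K) x :
  L1 + L2 + L3 + L4 = 2 * U ->
  L1 * L2 + L1 * L3 + L1 * L4 + L2 * L3 + L2 * L4 + L3 * L4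
    = U ^+ 2 - g * a2 - g * a1 ->
  L1 * L2 * L3 + L1 * L2 * L4 + L1 * L3 * L4 + L2 * L3 * L4
    = - 2 * U * (g * a1) ->
  L1 * L2 * L3 * L4 = g * a1 * (g * a2 - U ^+ 2 - gamma * g * a2) ->
  let T := reduced_step g gamma a1 a2 U in
  T L4 (T L3 (T L2 (T L1 x))) = (0, 0, 0, 0).
Proof.
move=> e1 e2 e3 e4 T; case: x => [[[a b] c] d].
pose x0 := (a, b, c, d); pose x1 := T 0 x0; pose x2 := T 0 x1.
pose x3 := T 0 x2; pose x4 := T 0 x3.
have E (f : K * K * K * K -> K) (fE : f = (fun x => x.1.1.1) \/
   f = (fun x => x.1.1.2) \/ f = (fun x => x.1.2) \/ f = (fun x => x.2)) :
   f (T L4 (T L3 (T L2 (T L1 x0)))) = 0.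
  transitivity (f x4 - (L1 + L2 + L3 + L4) * f x3
    + (L1 * L2 + L1 * L3 + L1 * L4 + L2 * L3 + L2 * L4 + L3 * L4) * f x2
    - (L1 * L2 * L3 + L1 * L2 * L4 + L1 * L3 * L4 + L2 * L3 * L4) * f x1
    + (L1 * L2 * L3 * L4) * f x0).
    by case: fE => [|[|[|]]] ->; rewrite /x4 /x3 /x2 /x1 /x0 /T /=; ring.
  rewrite e1 e2 e3 e4.
  by case: fE => [|[|[|]]] ->; rewrite /x4 /x3 /x2 /x1 /x0 /T /=; ring.
rewrite -/x0 [LHS]surjective_pairing [X in (X, _)]surjective_pairing.
rewrite [X in (X, _, _)]surjective_pairing.
rewrite (E (fun x => x.1.1.1))//; last by left.
rewrite (E (fun x => x.1.1.2))//; last by right; left.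
rewrite (E (fun x => x.1.2))//; last by right; right; left.
by rewrite (E (fun x => x.2))//; right; right; right.
Qed.

End ReducedStep.

Section Sufficiency.
Local Open Scope complex_scope.
Context {R : realType}.
Implicit Types (g gamma theta tau : R) (u : 'cV[R]_6).

Definition propagator g gamma u theta tau : 'M[R[i]]_6 :=
  expmx (- ('i * tau%:C) *: complexA g gamma u theta).

Lemma propagator_eigen g gamma u theta tau (l : R) (z : 'cV[R[i]]_6) :
  complexA g gamma u theta *m z = l%:C *: z ->
  propagator g gamma u theta tau *m z =
    (cos (tau * l) -i* sin (tau * l)) *: z.
Proof.
move=> Az; apply: expmx_eigen_imag.
by rewrite -scalemxAl Az scalerA rmorphM mulNr mulrA.
Qed.

Lemma complexA_shift_along g gamma u theta (L : R) a b c d :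
  (complexA g gamma u theta - (vel1 u theta + L)%:C%:M) *m along theta a b c d =
  let: (a', b', c', d') :=
    reduced_step g%:C gamma%:C (h1 u)%:C (h2 u)%:C
      (vel2 u theta - vel1 u theta)%:C L%:C (a, b, c, d) in
  along theta a' b' c' d'.
Proof.
rewrite mulmxBl complexA_along mul_scalar_mx -scaleNr alongZ alongD /=.
by move: (vel1 u theta) (vel2 u theta) => V W; rewrite rmorphB rmorphD; congr along; ring.
Qed.

Lemma norm1_complexA_shift g gamma u theta (B : R) :
  `|g| <= B -> `|gamma * g| <= B -> `|h1 u| <= B -> `|h2 u| <= B ->
  `|u2 u - u1 u| <= B -> `|v2 u - v1 u| <= B ->
  norm1 (complexA g gamma u theta - (vel1 u theta)%:C%:M) <= 72 * B.
Proof.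
move=> gB ggB h1B h2B uB vB.
have B0 : 0 <= B by apply: le_trans gB.
have X i j : `|Ax g gamma u i j - u1 u *+ (i == j)| <= B.
  rewrite mxE; case: i => [[|[|[|[|[|[|//]]]]]] i6];
   case: j => [[|[|[|[|[|[|//]]]]]] j6] /=;
   by rewrite ?mulr0n ?mulr1n ?subr0 ?subrr ?normr0.
have Y i j : `|Ay g gamma u i j - v1 u *+ (i == j)| <= B.
  rewrite mxE; case: i => [[|[|[|[|[|[|//]]]]]] i6];
   case: j => [[|[|[|[|[|[|//]]]]]] j6] /=;
   by rewrite ?mulr0n ?mulr1n ?subr0 ?subrr ?normr0.
have Z i j : normc ((complexA g gamma u theta - (vel1 u theta)%:C%:M) i j)
    <= 2 * B.
  rewrite !mxE -rmorphMn -rmorphB normc_real /vel1.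
  rewrite (_ : _ - _ = cos theta * (Ax g gamma u i j - u1 u *+ (i == j)) +
     sin theta * (Ay g gamma u i j - v1 u *+ (i == j))); last first.
    by rewrite !mxE -[in LHS]mulr_natr -[in RHS]mulr_natr; ring.
  rewrite (le_trans (ler_normD _ _))// mulr_natl mulr2n !normrM.
  rewrite lerD//; [rewrite -(mul1r B) ler_pM//|rewrite -(mul1r B) ler_pM//].
  - by rewrite ler_norml cos_geN1 cos_le1.
  - by rewrite ler_norml sin_geN1 sin_le1.
rewrite /norm1 (@le_trans _ _ (\sum_(i < 6) \sum_(j < 6) 2 * B))//.
  by rewrite ler_sum// => i _; rewrite ler_sum.
by rewrite !sumr_const !card_ord; lra.
Qed.

(** The transverse components only pick up phases; the longitudinal part is
    controlled by [spectral_bound]. The norm of the symbol shifted by an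
    eigenvalue involves only the difference of the velocities, not their size. *)
Lemma propagator_bounded g gamma u theta (B delta F s1 s2 s3 s4 : R) :
  0 < g -> 0 < h1 u -> 0 < h2 u -> 0 < delta ->
  g <= B -> `|gamma * g| <= B -> h1 u <= B -> h2 u <= B ->
  `|u2 u - u1 u| <= B -> `|v2 u - v1 u| <= B ->
  let c1 := Num.sqrt (g * h1 u) in
  vel2 u theta - vel1 u theta = c1 * F ->
  is_dispersion_roots F (h2 u / h1 u) gamma s1 s2 s3 s4 ->
  c1 * s1 + delta <= c1 * s2 -> c1 * s2 + delta <= c1 * s3 ->
  c1 * s3 + delta <= c1 * s4 ->
  (forall s, s \in [:: s1; s2; s3; s4] -> `|c1 * s| <= B) ->
  forall tau (z : 'cV[R[i]]_6), norm1 (propagator g gamma u theta tau *m z) <=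
    (2 * (2 * (73 * B) / delta) ^+ 3 + 2) * norm1 z.
Proof.
move=> g0 h10 h20 d0 gB ggB h1B h2B uB vB c1 UF roots s12 s23 s34 sB tau z.
have B0 : 0 <= B by apply: le_trans gB; exact: ltW.
have c1E : c1 ^+ 2 = g * h1 u by rewrite sqr_sqrtr// mulr_ge0 ?ltW.
set A := complexA g gamma u theta.
set E := propagator g gamma u theta tau.
set V := vel1 u theta.
have NA : norm1 (A - V%:C%:M) <= 72 * B.
  by apply: norm1_complexA_shift => //; rewrite gtr0_norm.
set T := 2 * (73 * B) / delta.
have T0 : 0 <= T by rewrite /T !mulr_ge0// invr_ge0 ltW.
(* On the longitudinal part the shifted symbol has four separated real
   eigenvalues, which annihilate it. *)
have Eal a b c d : norm1 (E *m along theta a b c d) <=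
    T ^+ 3 * norm1 (along theta a b c d).
  apply: (@spectral_bound _ _ A E (73 * B) delta (V + c1 * s1)%:C
    [:: (V + c1 * s2)%:C; (V + c1 * s3)%:C; (V + c1 * s4)%:C]) => //.
  - by rewrite mulr_ge0.
  - move=> m mE.
    have [s ss ->] : exists2 s, s \in [:: s1; s2; s3; s4] & m = (V + c1 * s)%:C.
      move: mE; rewrite !inE => /or4P[]/eqP->;
        [exists s1|exists s2|exists s3|exists s4] => //;
        by rewrite !inE eqxx ?orbT.
    split=> y; last first.
      by move=> /propagator_eigen ->; rewrite norm1Z normc_phase mul1r.
    rewrite rmorphD raddfD opprD addrA mulmxBl mul_scalar_mx.
    rewrite (le_trans (norm1B _ _))// norm1Z normc_real.
    rewrite (_ : 73 * B = 72 * B + B); last by ring.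
    rewrite mulrDl lerD//.
      by rewrite (le_trans (norm1M _ _))// ler_wpM2r// norm1_ge0.
    by rewrite ler_wpM2r ?norm1_ge0// sB.
  - have lt_ x y : c1 * x + delta <= c1 * y ->
        delta <= normc ((V + c1 * x)%:C - (V + c1 * y)%:C).
      move=> xy; rewrite -rmorphB normc_real distrC (le_trans _ (ler_norm _))//.
      lra.
    by rewrite /= !andbT !lt_//; lra.
  - pose stp (L : R) := reduced_step g%:C gamma%:C (h1 u)%:C (h2 u)%:C
      (vel2 u theta - vel1 u theta)%:C L%:C.
    have K : stp (c1 * s4) (stp (c1 * s3) (stp (c1 * s2) (stp (c1 * s1)
      (a, b, c, d)))) = (0, 0, 0, 0).
      have h2E : h2 u = h2 u / h1 u * h1 u by rewrite divfK// gt_eqF.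
      case: roots => e1 e2 e3 e4.
      apply: reduced_step_annihilated; rewrite UF -?rmorphM -?rmorphXn
        -?(rmorph_nat (real_complex R)) -?rmorphN -?rmorphM -?rmorphB -?rmorphD
        -?rmorphM -?rmorphB -?rmorphM; congr (_%:C).
      + by rewrite mulrCA -e1; ring.
      + transitivity (c1 ^+ 2 * (F ^+ 2 - h2 u / h1 u - 1)).
          by rewrite -e2; ring.
        by rewrite [in RHS]h2E exprMn c1E; ring.
      + transitivity (c1 ^+ 2 * c1 * (- 2 * F)); first by rewrite -e3; ring.
        by rewrite c1E; ring.
      + transitivity (c1 ^+ 2 * c1 ^+ 2 *
          (h2 u / h1 u - F ^+ 2 - gamma * (h2 u / h1 u))).
          by rewrite -e4; ring.
        by rewrite [in RHS]h2E exprMn c1E; ring.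
    rewrite /annihilated complexA_shift_along -/(stp _ _).
    case: (stp (c1 * s1) _) K => [[[a1 b1] c1'] d1] K.
    rewrite complexA_shift_along -/(stp _ _).
    case: (stp (c1 * s2) _) K => [[[a2 b2] c2'] d2] K.
    rewrite complexA_shift_along -/(stp _ _).
    case: (stp (c1 * s3) _) K => [[[a3 b3] c3'] d3] K.
    rewrite complexA_shift_along -/(stp _ _) K.
    transitivity (0 *: along theta 0 0 0 0); first by rewrite alongZ !mul0r.
    exact: scale0r.
(* On the transverse part the symbol is diagonal, the velocities being its
   eigenvalues. *)
have Eac e f : norm1 (E *m across theta e f) <= 2 * (normc e + normc f).
  have -> : across theta e f = across theta e 0 + across theta 0 f.
    by rewrite /across mk6D !mulr0 !addr0 !add0r.
  have Z l e' f' : l *: across theta e' f' = across theta (l * e') (l * f').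
    by rewrite /across mk6Z; congr mk6; ring.
  have C2 := cos_sin_norm_le2 theta.
  rewrite mulmxDr (le_trans (norm1D _ _))// mulrDr lerD//.
  - rewrite (@propagator_eigen _ _ _ _ _ (vel1 u theta)).
      rewrite norm1Z normc_phase mul1r norm1_across normc0 addr0.
      by rewrite ler_wpM2r ?normc_ge0.
    by rewrite complexA_across mulr0 Z mulr0.
  - rewrite (@propagator_eigen _ _ _ _ _ (vel2 u theta)).
      rewrite norm1Z normc_phase mul1r norm1_across normc0 add0r.
      by rewrite ler_wpM2r ?normc_ge0.
    by rewrite complexA_across mulr0 Z mulr0.
rewrite {1}(along_acrossK theta z) mulmxDr (le_trans (norm1D _ _))//.
have zE : norm1 z = normc (z (inord 0) 0) + normc (z (inord 1) 0) +
   normc (z (inord 2) 0) + normc (z (inord 3) 0) + normc (z (inord 4) 0) +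
   normc (z (inord 5) 0) by rewrite {1}(mk6K z) norm1_mk6.
have CS (x y : R[i]) : normc ((cos theta)%:C * x + (sin theta)%:C * y) <=
    normc x + normc y.
  rewrite (le_trans (normcD _ _))// !normcM !normc_real lerD//.
  - by rewrite ler_piMl ?normc_ge0// ler_norml cos_geN1 cos_le1.
  - by rewrite ler_piMl ?normc_ge0// ler_norml sin_geN1 sin_le1.
have CS' (x y : R[i]) : normc ((cos theta)%:C * x - (sin theta)%:C * y) <=
    normc x + normc y.
  by rewrite -mulrN (le_trans (CS _ _))// normcN.
have C2 := cos_sin_norm_le2 theta.
have C0 : 0 <= `|cos theta| + `|sin theta| by rewrite addr_ge0.
have p j := normc_ge0 (z (inord j) 0).
rewrite mulrDl lerD//.
- apply: le_trans (Eal _ _ _ _) _.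
  rewrite (_ : 2 * T ^+ 3 * norm1 z = T ^+ 3 * (2 * norm1 z)); last by ring.
  rewrite ler_wpM2l ?exprn_ge0// norm1_along.
  have : (`|cos theta| + `|sin theta|) *
    (normc ((cos theta)%:C * z (inord 2) 0 + (sin theta)%:C * z (inord 4) 0) +
     normc ((cos theta)%:C * z (inord 3) 0 + (sin theta)%:C * z (inord 5) 0)) <=
    2 * (normc (z (inord 2) 0) + normc (z (inord 4) 0) +
         (normc (z (inord 3) 0) + normc (z (inord 5) 0))).
    by rewrite ler_pM// ?addr_ge0 ?normc_ge0// lerD.
  by rewrite zE; have := p 0; have := p 1%N; lra.
- apply: le_trans (Eac _ _) _.
  rewrite ler_wpM2l// zE.
  have := CS' (z (inord 4) 0) (z (inord 2) 0).
  have := CS' (z (inord 5) 0) (z (inord 3) 0).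
  by have := p 0; have := p 1%N; lra.
Qed.

End Sufficiency.

(** * Consequences of a bounded propagator *)

Section Necessity.
Local Open Scope complex_scope.
Context {R : realType}.
Implicit Types (g gamma theta tau : R) (u : 'cV[R]_6).

Lemma exists_angle (x y : R) : x ^+ 2 + y ^+ 2 = 1 ->
  exists theta, [/\ 0 <= theta <= 2 * pi, cos theta = x & sin theta = y].
Proof.
move=> xy; have x1 : -1 <= x <= 1.
  by rewrite -ler_norml -ler_sqr ?nnegrE// real_normK ?num_real// expr1n; nra.
have a0 := acos_ge0 x1; have a1 := acos_lepi x1.
have yE : Num.sqrt (1 - x ^+ 2) = `|y| by rewrite -xy addrAC subrr add0r sqrtr_sqr.
have p0 := pi_ge0 R.
have [y0|y0] := leP 0 y.
  exists (acos x); split; [lra|exact: acosK|].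
  by rewrite sin_acos// yE ger0_norm.
exists (2 * pi - acos x); split; first by lra.
  by rewrite mulr_natl addrC cosD2pi cosN acosK.
by rewrite mulr_natl addrC sinD2pi sinN sin_acos// yE ltr0_norm// opprK.
Qed.

(** The unit vector of components U along (dx, dy) and sqrt(r - U^2) across it,
    with r the squared length of (dx, dy). *)
Lemma exists_direction (dx dy U : R) : U ^+ 2 <= dx ^+ 2 + dy ^+ 2 ->
  exists2 theta, 0 <= theta <= 2 * pi & cos theta * dx + sin theta * dy = U.
Proof.
move=> Ur; set r := dx ^+ 2 + dy ^+ 2 in Ur *.
have [r0|r0] := eqVneq r 0.
  move/eqP: r0; rewrite paddr_eq0 ?sqr_ge0// !sqrf_eq0 => /andP[/eqP dx0 /eqP dy0].
  exists 0; first by rewrite lexx mulr_ge0// pi_ge0.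
  move: Ur; rewrite /r dx0 dy0 expr0n/= addr0 => U0.
  have /eqP : U ^+ 2 = 0 by apply/eqP; rewrite eq_le U0 sqr_ge0.
  by rewrite sqrf_eq0 !mulr0 addr0 => /eqP.
have w0 : 0 <= r - U ^+ 2 by rewrite subr_ge0.
have wE := sqr_sqrtr w0; move: (Num.sqrt _) wE => w wE.
have [|theta [t02 cE sE]] :=
    @exists_angle ((U * dx - w * dy) / r) ((U * dy + w * dx) / r).
  rewrite !exprMn -mulrDl.
  have -> : (U * dx - w * dy) ^+ 2 + (U * dy + w * dx) ^+ 2 = r ^+ 2.
    transitivity ((U ^+ 2 + w ^+ 2) * r); first by rewrite /r; ring.
    by rewrite wE; ring.
  by rewrite -exprMn divff// expr1n.
exists theta => //; rewrite cE sE.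
transitivity (U * r / r); first by rewrite /r; field.
by rewrite mulfK.
Qed.

(** At tau = pi / (l - m) the two phases are opposite. *)
Lemma eigen_separation g gamma u theta (c l m : R) (x y : 'cV[R[i]]_6) :
  (forall tau (z : 'cV[R[i]]_6),
     norm1 (propagator g gamma u theta tau *m z) <= c * norm1 z) ->
  l != m ->
  complexA g gamma u theta *m x = l%:C *: x ->
  complexA g gamma u theta *m y = m%:C *: y ->
  norm1 (x + y) <= c * norm1 (x - y).
Proof.
move=> Pc lm Ax Ay; have lm0 : l - m != 0 by rewrite subr_eq0.
pose tau := pi / (l - m).
have E : tau * l = tau * m + pi by rewrite /tau; field.
apply: le_trans (Pc tau (x - y)).
rewrite mulmxBr (propagator_eigen tau Ax) (propagator_eigen tau Ay).
rewrite E cosDpi sinDpi opprK.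
rewrite (_ : - cos (tau * m) +i* sin (tau * m) = - (cos (tau * m) -i* sin (tau * m))).
  by rewrite scaleNr -opprD norm1N -scalerDr norm1Z normc_phase mul1r.
by apply/eqP; rewrite eq_complex /= opprK !eqxx.
Qed.

(** The eigenvector of the symbol for the root s of the dispersion relation. It
    is normalized by its first component, so that a sum of two of them is
    bounded below, and is polynomial in s, so that a difference is small with the
    difference of the roots. *)
Definition wave g u theta F (s : R) : 'cV[R[i]]_6 :=
  let c1 := Num.sqrt (g * h1 u) in
  along theta 1 (s ^+ 2 - 1)%:C (c1 / h1 u * s)%:C
    (c1 / h2 u * ((s - F) * (s ^+ 2 - 1)))%:C.

Lemma wave_eigenvector g gamma u theta F s : 0 < g -> 0 < h1 u -> 0 < h2 u ->
  let c1 := Num.sqrt (g * h1 u) in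
  vel2 u theta - vel1 u theta = c1 * F ->
  dispersion F (h2 u / h1 u) gamma s = 0 ->
  complexA g gamma u theta *m wave g u theta F s =
  (vel1 u theta + c1 * s)%:C *: wave g u theta F s.
Proof.
move=> g0 h10 h20 c1 UF ps.
have c1E : c1 ^+ 2 = g * h1 u by rewrite sqr_sqrtr// mulr_ge0 ?ltW.
have n1 : h1 u != 0 by rewrite gt_eqF.
have n2 : h2 u != 0 by rewrite gt_eqF.
rewrite /wave complexA_along alongZ -/c1.
have -> : vel2 u theta = vel1 u theta + c1 * F by rewrite -UF addrC subrK.
rewrite -(rmorph1 (real_complex R)).
move: (vel1 u theta) => V.
congr along; rewrite -?rmorphM -?rmorphD -?rmorphM -?rmorphD -?rmorphM; congr (_%:C).
- by field.
- by field.
- transitivity (g * s ^+ 2 + V * (c1 / h1 u * s)); first by ring.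
  transitivity (c1 ^+ 2 / h1 u * s ^+ 2 + V * (c1 / h1 u * s)); last by ring.
  by rewrite c1E; field.
- have gE : g = c1 ^+ 2 / h1 u by rewrite c1E mulfK.
  apply/eqP; rewrite -subr_eq0 {1}gE.
  rewrite (_ : _ - _ = - (c1 ^+ 2 / h2 u) * dispersion F (h2 u / h1 u) gamma s).
    by rewrite ps mulr0.
  by rewrite /dispersion; field; rewrite n1 n2.
Qed.

Definition stable g gamma u (c : R) : Prop :=
  forall theta, 0 <= theta <= 2 * pi -> forall tau (z : 'cV[R[i]]_6),
  norm1 (propagator g gamma u theta tau *m z) <= c * norm1 z.

Lemma vel_direction u theta : vel2 u theta - vel1 u theta =
  cos theta * (u2 u - u1 u) + sin theta * (v2 u - v1 u).
Proof. by rewrite /vel1 /vel2; ring. Qed.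

Lemma stable_direction g gamma u c (U : R) :
  U ^+ 2 <= (u2 u - u1 u) ^+ 2 + (v2 u - v1 u) ^+ 2 ->
  stable g gamma u c ->
  exists2 theta, vel2 u theta - vel1 u theta = U &
  forall tau (z : 'cV[R[i]]_6),
     norm1 (propagator g gamma u theta tau *m z) <= c * norm1 z.
Proof.
move=> /exists_direction[theta t02 tU] /(_ _ t02) Pc.
by exists theta => //; rewrite vel_direction.
Qed.

(** [eigen_separation] applied to two waves: their sum has norm at least 2, and
    their difference is a multiple of s - t. *)
Lemma stable_root_gap g gamma u (c B K F s t : R) : 0 < g -> 0 < h1 u -> 0 < h2 u ->
  stable g gamma u c -> 0 <= c -> 0 <= K ->
  let c1 := Num.sqrt (g * h1 u) in
  c1 / h1 u <= K -> c1 / h2 u <= K ->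
  (c1 * F) ^+ 2 <= (u2 u - u1 u) ^+ 2 + (v2 u - v1 u) ^+ 2 ->
  `|F| <= B -> `|s| <= B -> `|t| <= B -> s != t ->
  dispersion F (h2 u / h1 u) gamma s = 0 ->
  dispersion F (h2 u / h1 u) gamma t = 0 ->
  1 <= c * (2 * B + 2 * (K * (2 + 5 * B ^+ 2))) * `|s - t|.
Proof.
move=> g0 h10 h20 Pu c0 K0 c1 K1 K2 FU FB sB tB st ps pt.
have B0 : 0 <= B by apply: le_trans sB.
have [theta UF Pc] := stable_direction FU Pu.
have c10 : 0 < c1 by rewrite sqrtr_gt0 mulr_gt0.
have lm : vel1 u theta + c1 * s != vel1 u theta + c1 * t.
  by rewrite (inj_eq (addrI _)) (inj_eq (mulfI _))// gt_eqF.
have := eigen_separation Pc lm (wave_eigenvector g0 h10 h20 UF ps)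
  (wave_eigenvector g0 h10 h20 UF pt).
rewrite /wave -/c1 alongN !alongD !norm1_along.
rewrite subrr normc0 add0r -!rmorphB -!rmorphD !normc_real.
set CS := `|cos theta| + _.
have CS0 : 0 <= CS by rewrite addr_ge0.
have CS2 : CS <= 2 by exact: cos_sin_norm_le2.
move=> H.
have {}H : 1 <= c * (`|s ^+ 2 - 1 - (t ^+ 2 - 1)| + CS *
    (`|c1 / h1 u * s - c1 / h1 u * t| +
     `|c1 / h2 u * ((s - F) * (s ^+ 2 - 1)) - c1 / h2 u * ((t - F) * (t ^+ 2 - 1))|)).
  apply: le_trans H; rewrite -addrA ler_wpDr ?addr_ge0 ?mulr_ge0 ?addr_ge0//.
  by rewrite ger0_norm ?addr_ge0// lerDl.
apply: le_trans H _; rewrite -[leRHS]mulrA ler_wpM2l//.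
have nD (x y X Y : R) : `|x| <= X -> `|y| <= Y -> `|x + y| <= X + Y.
  by move=> xX yY; rewrite (le_trans (ler_normD _ _))// lerD.
have nM (x y X Y : R) : `|x| <= X -> `|y| <= Y -> `|x * y| <= X * Y.
  by move=> xX yY; rewrite normrM ler_pM.
rewrite [leRHS]mulrDl lerD//.
  rewrite (_ : _ - _ = (s + t) * (s - t)); last by ring.
  by rewrite normrM ler_wpM2r// mulr_natl mulr2n (nD).
rewrite -[leRHS]mulrA ler_pM ?addr_ge0//.
rewrite -mulrBr (_ : c1 / h2 u * _ - _ = c1 / h2 u *
   ((s ^+ 2 + s * t + t ^+ 2 - 1 - F * (s + t)) * (s - t))); last by ring.
have k1 : `|c1 / h1 u| <= K by rewrite ger0_norm// divr_ge0 ?ltW.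
have k2 : `|c1 / h2 u| <= K by rewrite ger0_norm// divr_ge0 ?ltW.
have p5 : `|s ^+ 2 + s * t + t ^+ 2 - 1 - F * (s + t)| <= 1 + 5 * B ^+ 2.
  rewrite (_ : 1 + 5 * B ^+ 2 = B * B + B * B + B * B + 1 + B * (B + B)); last by ring.
  apply: (nD); last by rewrite normrN; apply: (nM) => //; apply: (nD).
  apply: (nD); last by rewrite normrN1.
  by apply: (nD); [apply: (nD)|]; rewrite ?expr2; apply: (nM).
rewrite (_ : K * (2 + 5 * B ^+ 2) * `|s - t| =
   K * `|s - t| + K * ((1 + 5 * B ^+ 2) * `|s - t|)); last by ring.
by apply: lerD; apply: (nM) => //; apply: (nM).
Qed.

(** In the direction where F = 0 the roots come in pairs s and - s, and the wave of
    s plus or minus that of - s carries depths only or velocities only. Comparing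
    their norms gives |s| c1 (1 / h1 + (1 - s^2) / h2) <= 2 c, where s^2 is at
    least (1 - gamma) h2 / (h1 + h2) and 1 - s^2 at least gamma. *)
Lemma stable_depth g gamma u (c : R) : 0 < g -> 0 < h1 u -> 0 < h2 u ->
  0 < gamma < 1 -> 0 < c -> stable g gamma u c ->
  (1 - gamma) * gamma ^+ 2 * g / (8 * c ^+ 2) <= Num.min (h1 u) (h2 u).
Proof.
move=> g0 h10 h20 g01 c0 Pu; case/andP: (g01) => gam0 gam1.
set c1 := Num.sqrt (g * h1 u).
have c10 : 0 < c1 by rewrite sqrtr_gt0 mulr_gt0.
have c1E : c1 ^+ 2 = g * h1 u by rewrite sqr_sqrtr// mulr_ge0 ?ltW.
have h0 : 0 < h2 u / h1 u by rewrite divr_gt0.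
have [||theta UF Pc] := @stable_direction g gamma u c (c1 * 0) => //.
  by rewrite mulr0 expr0n/= addr_ge0 ?sqr_ge0.
have [||s [ps s1 sF]] := @dispersion_inner_root _ 0 _ gamma _ h0 g01.
- by rewrite lexx addr_ge0 ?sqrtr_ge0.
- by rewrite expr0n/=; exact: q_at0_gt0.
rewrite subr0 in sF.
have pE : (1 - s ^+ 2) * (h2 u / h1 u - s ^+ 2) = gamma * (h2 u / h1 u).
  by move: ps; rewrite /dispersion subr0; lra.
have pNs : dispersion 0 (h2 u / h1 u) gamma (- s) = 0.
  by move: ps; rewrite /dispersion !subr0 sqrrN.
have s0 : s != 0.
  apply/eqP => s0; move: pE; rewrite s0 expr0n/= !subr0 mul1r => pE.
  have : 0 < (1 - gamma) * (h2 u / h1 u) by rewrite mulr_gt0// subr_gt0.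
  lra.
have lm : vel1 u theta + c1 * s != vel1 u theta + c1 * (- s).
  rewrite (inj_eq (addrI _)) (inj_eq (mulfI (lt0r_neq0 c10))).
  by rewrite -subr_eq0 opprK -mulr2n mulrn_eq0.
have Ex := wave_eigenvector g0 h10 h20 UF ps.
have Ey := wave_eigenvector g0 h10 h20 UF pNs; rewrite -/c1 in Ey.
have ENy : complexA g gamma u theta *m - wave g u theta 0 (- s) =
    (vel1 u theta + c1 * - s)%:C *: - wave g u theta 0 (- s).
  by rewrite mulmxN Ey scalerN.
have := eigen_separation Pc lm Ex ENy.
have -> : wave g u theta 0 s - wave g u theta 0 (- s) =
    along theta 0 0 (2 * (c1 / h1 u * s))%:C
      (2 * (c1 / h2 u * (s * (s ^+ 2 - 1))))%:C.
  rewrite /wave -/c1 alongN alongD -!rmorphB sqrrN !subrr.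
  by congr along; congr (_%:C); ring.
have -> : wave g u theta 0 s - - wave g u theta 0 (- s) =
    along theta 2%:C (2 * (s ^+ 2 - 1))%:C 0 0.
  rewrite opprK /wave -/c1 alongD -(rmorph1 (real_complex R)) -!rmorphD sqrrN.
  rewrite -(rmorph0 (real_complex R)).
  by congr along; congr (_%:C); ring.
rewrite !norm1_along !normc0 !addr0 !add0r mulr0 addr0 !normc_real.
rewrite !normrM normr_nat (normrV (unitf_gt0 h10)) (normrV (unitf_gt0 h20)).
rewrite !(gtr0_norm c10) (gtr0_norm h10) (gtr0_norm h20).
have s21 : `|s ^+ 2 - 1| = 1 - s ^+ 2 by rewrite ltr0_norm ?opprB// subr_lt0.
rewrite s21.
have := cos_sin_norm_ge1 theta; set CS := _ + _ => CS1.
have yE : `|s| ^+ 2 = s ^+ 2 by rewrite real_normK ?num_real.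
have := normr_ge0 s; move: `|s| yE => al alE al0.
have y0 : 0 < s ^+ 2 by rewrite lt_neqAle sqr_ge0 eq_sym sqrf_eq0 s0.
move: (s ^+ 2) alE y0 s1 sF pE {s21 ps pNs lm Ex Ey ENy} => y alE y0 y1 yh pE.
set P := c1 / h1 u * al; set Q := c1 / h2 u * (al * (1 - y)).
have P0 : 0 <= P by rewrite !mulr_ge0// ?invr_ge0 ltW.
have Q0 : 0 <= Q by rewrite !mulr_ge0// ?invr_ge0 ?subr_ge0 ltW.
move=> H.
have {}H : P + Q <= 2 * c.
  have : 2 * P + 2 * Q <= CS * (2 * P + 2 * Q).
    by rewrite ler_peMl// addr_ge0// mulr_ge0.
  nra.
have h12 : 0 < h1 u + h2 u by rewrite addr_gt0.
have yge : (1 - gamma) * h2 u <= y * (h1 u + h2 u).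
  have : (1 - y) * (h2 u - y * h1 u) = gamma * h2 u.
    transitivity ((1 - y) * (h2 u / h1 u - y) * h1 u).
      by field; rewrite gt_eqF.
    by rewrite pE; field; rewrite gt_eqF.
  have := mulr_ge0 (sqr_ge0 y) (ltW h10); nra.
have yg : gamma <= 1 - y.
  have hh : h2 u / h1 u - y <= h2 u / h1 u by lra.
  have : gamma * (h2 u / h1 u) <= (1 - y) * (h2 u / h1 u).
    by rewrite -pE ler_wpM2l// subr_ge0 ltW.
  by rewrite ler_pM2r.
have P2 : y * g / h1 u <= 4 * c ^+ 2.
  have -> : y * g / h1 u = P ^+ 2.
    by rewrite /P !exprMn c1E alE; field; rewrite gt_eqF.
  have : P <= 2 * c by lra.
  nra.
have Q2 : y * g * h1 u / h2 u ^+ 2 * (1 - y) ^+ 2 <= 4 * c ^+ 2.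
  have -> : y * g * h1 u / h2 u ^+ 2 * (1 - y) ^+ 2 = Q ^+ 2.
    by rewrite /Q !exprMn c1E alE; field; rewrite gt_eqF.
  have : Q <= 2 * c by lra.
  nra.
have c8 : 0 < 8 * c ^+ 2 by rewrite mulr_gt0// exprn_gt0.
have g2 : gamma ^+ 2 <= 1 by rewrite expr_le1// ltW.
have [h12'|h12'] := leP (h1 u) (h2 u).
- rewrite ler_pdivrMr//.
  have yh2 : (1 - gamma) / 2 <= y.
    rewrite ler_pdivrMr// -(ler_pM2r h20); nra.
  move: P2; rewrite ler_pdivrMr// => P2.
  have : (1 - gamma) / 2 * g <= y * g by rewrite ler_pM2r.
  have : (1 - gamma) * gamma ^+ 2 * g <= (1 - gamma) * 1 * g.
    by rewrite ler_pM2r// ler_pM2l// subr_gt0.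
  lra.
- rewrite ler_pdivrMr//.
  have yh2 : (1 - gamma) * h2 u / 2 <= y * h1 u.
    by rewrite ler_pdivrMr//; nra.
  have Q3 : y * h1 u * g * gamma ^+ 2 <= 4 * c ^+ 2 * h2 u ^+ 2.
    rewrite -ler_pdivrMr ?exprn_gt0//; apply: le_trans Q2.
    rewrite (_ : y * g * h1 u / h2 u ^+ 2 * (1 - y) ^+ 2 =
       y * h1 u * g * (1 - y) ^+ 2 / h2 u ^+ 2); last by field; rewrite gt_eqF.
    rewrite ler_pM2r ?invr_gt0 ?exprn_gt0// ler_pM2l ?mulr_gt0//.
    by rewrite ler_sqr ?nnegrE ?subr_ge0 ?(ltW gam0) ?(ltW y1).
  have gg : 0 < g * gamma ^+ 2 by rewrite mulr_gt0// exprn_gt0.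
  have : (1 - gamma) * h2 u / 2 * (g * gamma ^+ 2) <= y * h1 u * (g * gamma ^+ 2).
    by rewrite ler_pM2r.
  by move=> H3; rewrite -(ler_pM2r h20); lra.
Qed.

(** In the direction where F = 0 the square of the shifted symbol acts on the
    velocities (r1, r2) through a 2 x 2 matrix whose determinant is a positive
    multiple of 1 - gamma. If gamma >= 1 it has an eigenvalue mu <= 0, and [expmx_growth]
    applies to the eigenvector. *)
Lemma stable_gamma_lt1 g gamma u (c : R) : 0 < g -> 0 < h1 u -> 0 < h2 u ->
  0 < gamma -> stable g gamma u c -> gamma < 1.
Proof.
move=> g0 h10 h20 gam0 Pu; rewrite ltNge; apply/negP => gam1.
have [||theta UF Pc] := @stable_direction g gamma u c 0 => //.
  by rewrite expr0n/= addr_ge0 ?sqr_ge0.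
pose b := g * (h1 u + h2 u).
pose D := b ^+ 2 - 4 * (g ^+ 2 * h1 u * h2 u * (1 - gamma)).
have b0 : 0 < b by rewrite mulr_gt0// addr_gt0.
have bD : b ^+ 2 <= D.
  rewrite /D lerDl oppr_ge0 pmulr_rle0// pmulr_rle0 ?subr_le0//.
  by rewrite !mulr_gt0// exprn_gt0.
have D0 : 0 <= D by rewrite (le_trans _ bD)// sqr_ge0.
pose mu := (b - Num.sqrt D) / 2.
have muE : mu ^+ 2 = b * mu - g ^+ 2 * h1 u * h2 u * (1 - gamma).
  have := sqr_sqrtr D0; rewrite {2}/D => dE.
  transitivity (b * mu + ((Num.sqrt D) ^+ 2 - b ^+ 2) / 4).
    by rewrite /mu; field.
  by rewrite dE; field.
have mu0 : mu <= 0.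
  rewrite /mu pmulr_lle0 ?invr_gt0// subr_le0.
  by rewrite -(ler_sqr) ?nnegrE ?sqrtr_ge0 ?(ltW b0)// sqr_sqrtr.
pose r1 := g * h2 u; pose r2 := mu - g * h1 u.
pose z := along theta 0 0 r1%:C r2%:C.
pose V := vel1 u theta.
have VE : vel2 u theta = V by apply/eqP; rewrite -subr_eq0 UF.
pose t := (c * norm1 z + 1) / (h1 u * r1).
have r10 : 0 < h1 u * r1 by rewrite !mulr_gt0.
have z0 := norm1_ge0 z.
have c0 : 0 <= c * norm1 z by apply: le_trans (norm1_ge0 _) (Pc 0 z).
have t0 : 0 < t by rewrite divr_gt0// ltr_wpDl.
pose w := along theta (h1 u * r1)%:C (h2 u * r2)%:C 0 0.
pose A := complexA g gamma u theta.
have Az : (A - V%:C%:M) *m z = w.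
  rewrite -[V]addr0 complexA_shift_along /= UF /w.
  by rewrite -(rmorph0 (real_complex R)); congr along;
    rewrite -?rmorphM -?rmorphD -?rmorphM -?rmorphB -?rmorphM -?rmorphD;
    congr (_%:C); ring.
have Aw : (A - V%:C%:M) *m w = mu%:C *: z.
  rewrite -[V]addr0 complexA_shift_along /= UF /z alongZ.
  rewrite -(rmorph0 (real_complex R)); congr along;
    rewrite -?rmorphM -?rmorphD -?rmorphM -?rmorphD -?rmorphM -?rmorphB
      -?rmorphM -?rmorphD;
    congr (_%:C).
  - by ring.
  - by ring.
  - by rewrite /r1 /r2; ring.
  - by move: muE; rewrite /r1 /r2 /b; move: (mu) => m; lra.
pose M : 'M[R[i]]_6 := - ('i * (- t)%:C) *: (A - V%:C%:M).
have PE : propagator g gamma u theta (- t) =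
    (cos (- t * V) -i* sin (- t * V)) *: expmx M.
  rewrite /propagator -(expmx_shift M (exp_series_imag (- t * V))).
  congr expmx; rewrite /M scalerBr -/A.
  have cV : - ('i * (- t)%:C) * V%:C = - ('i * (- t * V)%:C).
    by rewrite rmorphM mulNr mulrA.
  by rewrite scale_scalar_mx cV addrC subrK.
have := Pc (- t) z; rewrite PE -scalemxAl norm1Z normc_phase mul1r => H.
have := normc_le_norm1 (expmx M *m z) (inord 0) 0.
have : t * (h1 u * r1) <= normc ((expmx M *m z) (inord 0) 0).
  apply: (@expmx_growth _ _ M z (- ('i * (- t)%:C) *: w) (t ^+ 2 * - mu)).
  - by rewrite /M -scalemxAl Az.
  - rewrite /M -scalemxAl -scalemxAr Aw !scalerA; congr (_ *: _).
    apply/eqP; rewrite eq_complex /=; apply/andP; split; apply/eqP; ring.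
  - by rewrite mulr_ge0 ?sqr_ge0// oppr_ge0.
  - by rewrite /z /along mxE inordK.
  - rewrite /w /along !mxE inordK//=.
    apply/eqP; rewrite eq_complex /=; apply/andP; split; apply/eqP; ring.
  - by rewrite mulr_ge0 ?ltW.
rewrite /t divfK ?gt_eqF//; lra.
Qed.

End Necessity.

(** * Multiplication operators on L^2 *)

Section Cnorm.
Local Open Scope complex_scope.
Context {R : realType} {n : nat}.
Implicit Types (a b z : 'cV[R[i]]_n).

Lemma cnormE z : cnorm z = Num.sqrt (\sum_j normc (z j 0) ^+ 2).
Proof.
congr Num.sqrt; apply: eq_bigr => j _.
by case: (z j 0) => x y /=; rewrite sqr_sqrtr// addr_ge0 ?sqr_ge0.
Qed.

Lemma sqr_cnorm z : cnorm z ^+ 2 = \sum_j normc (z j 0) ^+ 2.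
Proof. by rewrite cnormE sqr_sqrtr// sumr_ge0// => j _; rewrite sqr_ge0. Qed.

Lemma cnorm_ge0 z : 0 <= cnorm z. Proof. exact: sqrtr_ge0. Qed.

Lemma normc_le_cnorm z j : normc (z j 0) <= cnorm z.
Proof.
rewrite -ler_sqr ?nnegrE ?normc_ge0 ?cnorm_ge0// sqr_cnorm.
by rewrite (bigD1 j)//= lerDl sumr_ge0// => i _; rewrite sqr_ge0.
Qed.

Lemma norm1_cV z : norm1 z = \sum_j normc (z j 0).
Proof. by apply: eq_bigr => i _; rewrite big_ord1. Qed.

Lemma norm1_le_cnorm z : norm1 z <= n%:R * cnorm z.
Proof.
rewrite norm1_cV (@le_trans _ _ (\sum_(j < n) cnorm z))//.
  by rewrite ler_sum// => j _; exact: normc_le_cnorm.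
by rewrite sumr_const card_ord mulr_natl.
Qed.

(** Stated with the entrywise norm of the perturbation, which makes it
    elementary: expand the squares and bound every |b_j| by [cnorm b]. *)
Lemma cnorm_perturb a b : cnorm a <= cnorm b + norm1 (a - b).
Proof.
have D0 := norm1_ge0 (a - b); have b0 := cnorm_ge0 b.
rewrite -ler_sqr ?nnegrE ?cnorm_ge0 ?addr_ge0// sqr_cnorm.
set d := fun j => normc (a j 0 - b j 0).
have dE : norm1 (a - b) = \sum_j d j.
  by rewrite norm1_cV; apply: eq_bigr => j _; rewrite !mxE.
have d0 j : 0 <= d j by exact: normc_ge0.
have dj j : d j <= norm1 (a - b).
  by rewrite dE (bigD1 j)//= lerDl sumr_ge0.
have H j : normc (a j 0) ^+ 2 <=
    normc (b j 0) ^+ 2 + (2 * cnorm b + norm1 (a - b)) * d j.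
  have aj : normc (a j 0) <= normc (b j 0) + d j.
    by rewrite -[a j 0](subrK (b j 0)) addrC normcD.
  have := normc_ge0 (a j 0); have := normc_ge0 (b j 0).
  have := normc_le_cnorm b j; have := dj j; have := d0 j.
  move: (normc (a j 0)) (normc (b j 0)) (d j) aj => x y e xy e0 eD yb y0 x0.
  have : x ^+ 2 <= (y + e) ^+ 2 by rewrite ler_sqr ?nnegrE ?addr_ge0.
  have : e * e <= norm1 (a - b) * e by rewrite ler_wpM2r.
  have : y * e <= cnorm b * e by rewrite ler_wpM2r.
  lra.
apply: (@le_trans _ _ (\sum_j (normc (b j 0) ^+ 2 +
   (2 * cnorm b + norm1 (a - b)) * d j))).
  by rewrite ler_sum// => j _; exact: H.
by rewrite big_split/= -big_distrr/= -sqr_cnorm -dE; lra.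
Qed.

Lemma cnorm0 : cnorm (0 : 'cV[R[i]]_n) = 0.
Proof.
by rewrite cnormE big1 ?sqrtr0// => j _; rewrite mxE normc0 expr0n.
Qed.

Lemma cnorm_le_norm1 z : cnorm z <= norm1 z.
Proof. by have := cnorm_perturb z 0; rewrite subr0 cnorm0 add0r. Qed.

Lemma cnormZ k z : cnorm (k *: z) = normc k * cnorm z.
Proof.
rewrite !cnormE -[normc k]ger0_norm ?normc_ge0// -sqrtr_sqr -sqrtrM ?sqr_ge0//.
by rewrite big_distrr/=; congr Num.sqrt; apply: eq_bigr => j _;
  rewrite mxE normcM exprMn.
Qed.

End Cnorm.

Section L2.
Local Open Scope complex_scope.
Context {R : realType}.
Local Open Scope ereal_scope.
Local Notation mu2 := (@lebesgue_measure R \x @lebesgue_measure R).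

(** The integral of a nonnegative function is a supremum over the simple
    functions below it, so it is monotone without measurability; this spares the
    measurability of X |-> exp(- i tau A(u0(X), theta)) f(X). *)
Lemma le_integral_nonmeasurable d (T : measurableType d)
    (mu : {measure set T -> \bar R}) (f g : T -> \bar R) :
  (forall x, 0 <= f x) -> (forall x, f x <= g x) ->
  \int[mu]_x f x <= \int[mu]_x g x.
Proof.
move=> f0 fg; have g0 x : 0 <= g x by rewrite (le_trans (f0 x)).
rewrite !ge0_integralE// !patch_setT.
apply: ge_ereal_sup => _ [h /= hf <-]; apply: ereal_sup_ubound.
by exists h => //= x; rewrite (le_trans (hf x)).
Qed.

Lemma L2norm_le n (f : R * R -> 'cV[R[i]]_n) (c : R) : (0 <= c)%R ->
  (L2norm f <= c%:E) = (\int[mu2]_X (cnorm (f X) ^+ 2)%:E <= (c ^+ 2)%:E).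
Proof.
move=> c0; rewrite /L2norm Lnorm.unlock.
have -> : \int[mu2]_X (`|(cnorm (f X))%:E| `^ 2) =
          \int[mu2]_X (cnorm (f X) ^+ 2)%:E.
  apply: eq_integral => X _.
  by rewrite gee0_abs ?lee_fin ?cnorm_ge0// poweR_EFin powR_mulrn ?cnorm_ge0.
have I0 : 0 <= \int[mu2]_X (cnorm (f X) ^+ 2)%:E.
  by apply: integral_ge0 => X _; rewrite lee_fin sqr_ge0.
have c2 : (c ^+ 2)%:E `^ 2^-1 = c%:E.
  by rewrite poweR_EFin -powR_mulrn// -powRrM mulfV ?powRr1.
have I2 : (\int[mu2]_X (cnorm (f X) ^+ 2)%:E) `^ 2^-1 `^ 2 =
     \int[mu2]_X (cnorm (f X) ^+ 2)%:E.
  by rewrite -poweRrM mulVf// poweRe1.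
apply/idP/idP => H.
- rewrite -I2 -powR_mulrn// -poweR_EFin.
  by apply: gt0_ler_poweR => //; rewrite in_itv/= leey andbT ?poweR_ge0 ?lee_fin.
- rewrite -c2.
  by apply: gt0_ler_poweR; rewrite ?invr_ge0// in_itv/= leey andbT// lee_fin sqr_ge0.
Qed.

End L2.

Section MultiplicationOperator.
Local Open Scope complex_scope.
Context {R : realType}.
Local Notation Re := (@complex.Re R).
Local Notation Im := (@complex.Im R).
Local Notation mu2 := (@lebesgue_measure R \x @lebesgue_measure R)%E.

Lemma sqr_normc (x : R[i]) : normc x ^+ 2 = Re x ^+ 2 + Im x ^+ 2.
Proof. by case: x => a b /=; rewrite sqr_sqrtr// addr_ge0 ?sqr_ge0. Qed.

Lemma measurable_sqr_cnorm n (f : R * R -> 'cV[R[i]]_n) : measurable_cvec f ->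
  measurable_fun setT (fun X => cnorm (f X) ^+ 2).
Proof.
move=> mf.
have -> : (fun X => cnorm (f X) ^+ 2) =
    (fun X => \sum_j (Re (f X j 0) ^+ 2 + Im (f X j 0) ^+ 2)).
  apply/funext => X; rewrite sqr_cnorm.
  by apply: eq_bigr => j _; rewrite sqr_normc.
apply: measurable_sum => j; have [mr mi] := mf j.
by apply: measurable_funD; apply: measurable_funX.
Qed.

Lemma L2opnorm_le n (M : R * R -> 'M[R[i]]_n) (c : R) : 0 <= c ->
  (forall X z, cnorm (M X *m z) <= c * cnorm z) -> (L2opnorm M <= c%:E)%E.
Proof.
move=> c0 Mc; apply: ge_ereal_sup => _ [f [mf f1] <-].
rewrite L2norm_le//.
apply: (@le_trans _ _ (\int[mu2]_X ((c ^+ 2)%:E * (cnorm (f X) ^+ 2)%:E))%E).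
  apply: le_integral_nonmeasurable => X; first by rewrite lee_fin sqr_ge0.
  by rewrite -EFinM lee_fin -exprMn ler_sqr ?nnegrE ?mulr_ge0 ?cnorm_ge0.
rewrite ge0_integralZl_EFin ?sqr_ge0//; last 2 first.
- by move=> X _; rewrite lee_fin sqr_ge0.
- by apply/measurable_EFinP; exact: measurable_sqr_cnorm.
move: f1; rewrite L2norm_le// expr1n => f1.
by rewrite -[leRHS]mule1 lee_wpmul2l// lee_fin sqr_ge0.
Qed.

(** Test the operator on the indicator function of W times a multiple of z, of
    norm 1. *)
Lemma L2opnorm_test n (M : R * R -> 'M[R[i]]_n) (z : 'cV[R[i]]_n) (c al : R)
    (W : set (R * R)) : 0 <= c -> 0 <= al ->
  measurable W -> (0 < mu2 W)%E -> (mu2 W < +oo)%E ->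
  (forall X, W X -> al <= cnorm (M X *m z)) -> (L2opnorm M <= c%:E)%E ->
  al <= c * cnorm z.
Proof.
move=> c0 al0 mW W0 Woo Mal Mc.
have [z0|zn0] := eqVneq (cnorm z) 0.
  have [X WX] : W !=set0.
    by apply/set0P; apply: contraTneq W0 => ->; rewrite measure0 ltxx.
  have zE : z = 0.
    apply/matrixP => i j; rewrite (ord1 j) mxE; apply: eq0_normc.
    by apply/eqP; rewrite eq_le normc_ge0 andbT -z0 normc_le_cnorm.
  by have := Mal X WX; rewrite zE mulmx0 cnorm0 mulr0.
have z0 : 0 < cnorm z by rewrite lt_neqAle eq_sym zn0 cnorm_ge0.
pose w := fine (mu2 W).
have wE : (w%:E = mu2 W)%E.
  by rewrite fineK// ge0_fin_numE.
have w0 : 0 < w by rewrite -lte_fin wE.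
pose k := (cnorm z * Num.sqrt w)^-1.
have k0 : 0 <= k by rewrite invr_ge0 mulr_ge0 ?cnorm_ge0 ?sqrtr_ge0.
have k2 : k ^+ 2 * (cnorm z ^+ 2 * w) = 1.
  have sw := sqr_sqrtr (ltW w0); rewrite /k exprVn exprMn sw mulVf//.
  by rewrite mulf_neq0 ?expf_neq0 ?gt_eqF.
pose f X : 'cV[R[i]]_n := (k * \1_W X)%:C *: z.
have mind : measurable_fun setT (fun X => k * \1_W X : R).
  by apply: measurable_funM => //; exact: measurable_indic.
have mf : measurable_cvec f.
  move=> j; have fE X : f X j 0 = (k * \1_W X)%:C * z j 0 by rewrite mxE.
  split.
  - have -> : (fun X => Re (f X j 0)) = (fun X => k * \1_W X * Re (z j 0)).
      by apply/funext => X; rewrite fE Re_realM.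
    exact: measurable_funM.
  - have -> : (fun X => Im (f X j 0)) = (fun X => k * \1_W X * Im (z j 0)).
      by apply/funext => X; rewrite fE Im_realM.
    exact: measurable_funM.
have i2 X : (\1_W X : R) ^+ 2 = \1_W X.
  by rewrite indicE; case: (_ \in _); rewrite /= ?expr1n ?expr0n.
have Iind (r : R) : 0 <= r -> (\int[mu2]_X (r * \1_W X)%:E = (r * w)%:E)%E.
  move=> r0; under eq_integral do rewrite EFinM.
  rewrite ge0_integralZl_EFin//; last by
    apply/measurable_EFinP; exact: measurable_indic.
  by rewrite integral_indic// setIT EFinM wE.
have f1 : (L2norm f <= 1)%E.
  rewrite L2norm_le//; under eq_integral => X _.
    rewrite cnormZ normc_real exprMn real_normK ?num_real// exprMn i2 mulrAC.
    over.
  by rewrite Iind ?mulr_ge0 ?cnorm_ge0// expr1n -mulrA k2.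
have : (L2norm (fun X => M X *m f X) <= c%:E)%E.
  by apply: le_trans Mc; apply: ereal_sup_ubound; exists f.
rewrite L2norm_le// => H.
have : (\int[mu2]_X (k ^+ 2 * al ^+ 2 * \1_W X)%:E <= (c ^+ 2)%:E)%E.
  apply: le_trans H; apply: le_integral_nonmeasurable => X.
    by rewrite lee_fin mulr_ge0 ?mulr_ge0 ?sqr_ge0.
  rewrite lee_fin /f -scalemxAr cnormZ normc_real exprMn real_normK ?num_real//.
  rewrite exprMn i2; have [XW|XW] := pselect (W X); last first.
    by rewrite indicE memNset// !mulr0 mul0r.
  rewrite indicE mem_set// !mulr1 ler_wpM2l ?sqr_ge0//.
  by rewrite ler_sqr ?nnegrE ?cnorm_ge0// Mal.
rewrite Iind ?mulr_ge0 ?sqr_ge0// lee_fin => {}H.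
rewrite -ler_sqr ?nnegrE ?mulr_ge0 ?cnorm_ge0// exprMn.
rewrite -[leLHS]mulr1 -k2.
rewrite (_ : al ^+ 2 * _ = k ^+ 2 * al ^+ 2 * w * cnorm z ^+ 2); last by ring.
by rewrite ler_wpM2r ?sqr_ge0.
Qed.

(** The plane is a countable union of squares of finite measure. *)
Lemma finite_positive_piece (W : set (R * R)) : measurable W ->
  ~ (mu2).-negligible W ->
  exists W', [/\ measurable W', W' `<=` W, (0 < mu2 W')%E & (mu2 W' < +oo)%E].
Proof.
move=> mW nW.
pose I n : set (measurableTypeR R) := ball (0 : R) n.+1%:R.
pose Q n : set (R * R) := I n `*` I n.
have mI n : measurable (I n) by exact: measurable_realfun.measurable_ball.
have mQ n : measurable (Q n) := measurableX (mI n) (mI n).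
have mWQ n := measurableI _ _ mW (mQ n).
have [n Wn] : exists n, mu2 (W `&` Q n) != 0%E.
  apply/not_existsP => H; apply: nW.
  have : (mu2).-negligible (\bigcup_n (W `&` Q n)).
    apply: negligible_bigcup => n; apply/(negligibleP mu2 (mWQ n)).
    by apply/eqP/negPn/negP; exact: H.
  apply: negligibleS => -[x y] Wxy.
  pose m := Num.truncn (Num.max `|x| `|y|).
  have mb : Num.max `|x| `|y| < m.+1%:R by exact: truncnS_gt.
  exists m => //; split => //; split; rewrite /I /ball /= sub0r normrN;
    by apply: le_lt_trans mb; rewrite le_max lexx ?orbT.
exists (W `&` Q n); split => //.
  by rewrite lt0e Wn measure_ge0.
apply: (@le_lt_trans _ _ (mu2 (Q n))).
  by apply: le_measure; rewrite ?inE;[exact: mWQ|exact: mQ|exact: subIsetr].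
rewrite [X in (X < _)%E](product_measure1E _ _ (mI n) (mI n)).
rewrite [X in (X * _)%E]lebesgue_measure_ball//.
by rewrite [X in (_ * X)%E]lebesgue_measure_ball// -EFinM ltry.
Qed.

End MultiplicationOperator.

(** * Reduction to pointwise bounds *)

Section HyperbolicPointwise.
Local Open Scope complex_scope.
Context {R : realType}.
Implicit Types (g gamma theta tau : R) (u : 'cV[R]_6).
Local Notation mu2 := (@lebesgue_measure R \x @lebesgue_measure R)%E.

Lemma complexA_lipschitz g gamma theta u (w : 'cV[R]_6) (e : R) :
  (forall j, `|u j 0 - w j 0| <= e) ->
  norm1 (complexA g gamma u theta - complexA g gamma w theta) <= 72 * e.
Proof.
move=> uw; have e0 : 0 <= e by apply: le_trans (uw ord0).
have X i j : `|Ax g gamma u i j - Ax g gamma w i j| <= e.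
  rewrite !mxE; case: i => [[|[|[|[|[|[|//]]]]]] i6];
   case: j => [[|[|[|[|[|[|//]]]]]] j6] /=;
   rewrite ?subrr ?normr0 //; exact: uw.
have Y i j : `|Ay g gamma u i j - Ay g gamma w i j| <= e.
  rewrite !mxE; case: i => [[|[|[|[|[|[|//]]]]]] i6];
   case: j => [[|[|[|[|[|[|//]]]]]] j6] /=;
   rewrite ?subrr ?normr0 //; exact: uw.
rewrite /norm1 (@le_trans _ _ (\sum_(i < 6) \sum_(j < 6) 2 * e))//; last first.
  by rewrite !sumr_const !card_ord; lra.
rewrite ler_sum// => i _; rewrite ler_sum// => j _.
rewrite /complexA -map_mxB mxE normc_real.
rewrite (_ : (Atheta g gamma u theta - Atheta g gamma w theta) i j =
   cos theta * (Ax g gamma u i j - Ax g gamma w i j) +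
   sin theta * (Ay g gamma u i j - Ay g gamma w i j)); last first.
  by rewrite /Atheta; move: (Ax _ _ _) (Ax _ _ _) (Ay _ _ _) (Ay _ _ _) =>
    ? ? ? ?; rewrite !mxE; ring.
rewrite (le_trans (ler_normD _ _))// mulr_natl mulr2n !normrM.
rewrite lerD//; rewrite -(mul1r e) ler_pM//.
- by rewrite ler_norml cos_geN1 cos_le1.
- by rewrite ler_norml sin_geN1 sin_le1.
Qed.

Lemma measurable_box (u0 : R * R -> 'cV[R]_6) (a : 'cV[R]_6) (e : R) :
  (forall j, measurable_fun setT (fun X => u0 X j 0)) ->
  measurable (u0 @^-1` [set y | forall j, ball (a j 0) e (y j 0)]).
Proof.
move=> mu.
have -> : u0 @^-1` [set y | forall j, ball (a j 0) e (y j 0)] =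
    \bigcap_(j in [set: 'I_6]) ([set: R * R] `&`
       (fun X => u0 X j 0) @^-1` (ball (a j 0) e : set (measurableTypeR R))).
  apply/seteqP; split => X /= H j; first by move=> _; split => //; exact: H.
  by have [] := H j Logic.I.
apply: fin_bigcap_measurable => // j _; apply: mu => //.
exact: measurable_realfun.measurable_ball.
Qed.

(** If the bound failed for z at X, then by continuity of the exponential it would
    fail on the preimage of a small box around u0(X), which is not negligible, and
    an indicator function would contradict the operator bound. The factor 6
    compares [norm1] with [cnorm]. *)
Lemma hyperbolic_stable g gamma (u0 : R * R -> 'cV[R]_6) :
  (forall j, measurable_fun setT (fun X => u0 X j 0)) ->
  values_essential u0 -> hyperbolic g gamma u0 ->
  exists2 c : R, 0 < c & forall X, stable g gamma (u0 X) c.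
Proof.
move=> u0_meas u0_ess [c [c0 hyp]].
exists (6 * c); first by rewrite mulr_gt0.
move=> X theta t02 tau z.
have opc : (L2opnorm (fun Y => propagator g gamma (u0 Y) theta tau) <= c%:E)%E.
  apply: le_trans (hyp theta t02); apply: ereal_sup_ubound.
  by exists tau.
suff H : cnorm (propagator g gamma (u0 X) theta tau *m z) <= c * cnorm z.
  rewrite (le_trans (norm1_le_cnorm _))// -mulrA ler_wpM2l//.
  by rewrite (le_trans H)// ler_wpM2l ?(ltW c0)// cnorm_le_norm1.
apply/ler_addgt0Pr => eps eps0.
have z0 := norm1_ge0 z.
have z1 : 0 < norm1 z + 1 by rewrite ltr_wpDl.
have [d d0 Hd] := expmx_continuous
  (- ('i * tau%:C) *: complexA g gamma (u0 X) theta) (divr_gt0 eps0 z1).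
have t1 : 0 < `|tau| + 1 by rewrite ltr_wpDl.
pose e := d / (72 * (`|tau| + 1)).
have e0 : 0 < e by rewrite divr_gt0// mulr_gt0.
pose V := [set y : 'cV[R]_6 | forall j, ball (u0 X j 0) e (y j 0)].
have Vn : nbhs (u0 X) V.
  apply: filterS (nbhsx_ballx (u0 X) e e0) => y [_ yb] j.
  exact: yb.
have [W [mW WV W0 Woo]] := finite_positive_piece
  (measurable_box (u0 X) e u0_meas) (u0_ess X V Vn).
rewrite -lerBlDr.
have [lt0|ge0] := ltP (cnorm (propagator g gamma (u0 X) theta tau *m z) - eps) 0.
  by rewrite (le_trans (ltW lt0))// mulr_ge0 ?cnorm_ge0// ltW.
apply: (L2opnorm_test (ltW c0) ge0 mW W0 Woo _ opc) => Y /WV /= VY.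
rewrite lerBlDr; apply: le_trans (cnorm_perturb _
  (propagator g gamma (u0 Y) theta tau *m z)) _; rewrite lerD2l.
rewrite -mulmxBl (le_trans (norm1M _ _))// -opprB norm1N.
have /Hd/ltW H : norm1 (- ('i * tau%:C) *: complexA g gamma (u0 Y) theta -
    - ('i * tau%:C) *: complexA g gamma (u0 X) theta) < d.
  rewrite -scalerBr norm1Z normcN normcM normc_real.
  have -> : normc ('i : R[i]) = 1 by rewrite /= expr0n expr1n add0r sqrtr1.
  rewrite mul1r.
  have : norm1 (complexA g gamma (u0 Y) theta - complexA g gamma (u0 X) theta)
    <= 72 * e.
    apply: complexA_lipschitz => j; rewrite distrC ltW//; exact: VY.
  move=> /(ler_wpM2l (normr_ge0 tau)) H; apply: le_lt_trans H _.
  rewrite /e (_ : `|tau| * _ = d * (`|tau| / (`|tau| + 1))); last first.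
    by field; rewrite gt_eqF.
  by rewrite gtr_pMr// ltr_pdivrMr// mul1r ltrDl.
apply: le_trans (ler_wpM2r z0 H) _.
rewrite mulrAC ler_pdivrMr// ler_wpM2l ?(ltW eps0)//; lra.
Qed.

Lemma stable_hyperbolic g gamma (u0 : R * R -> 'cV[R]_6) (c : R) : 0 < c ->
  (forall X, stable g gamma (u0 X) c) -> hyperbolic g gamma u0.
Proof.
move=> c0 Pc; exists (6 * c); split; first by rewrite mulr_gt0.
move=> theta t02; apply: ge_ereal_sup => _ [tau _ <-].
apply: L2opnorm_le => [|X z]; first by rewrite mulr_ge0// ltW.
rewrite (le_trans (cnorm_le_norm1 _))// (le_trans (Pc X theta t02 tau z))//.
rewrite (_ : 6 * c * cnorm z = c * (6 * cnorm z)); last by ring.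
by rewrite ler_wpM2l ?(ltW c0)// norm1_le_cnorm.
Qed.

End HyperbolicPointwise.

(** * Uniform constants and the characterization *)

Section Uniform.
Context {R : realType}.
Implicit Types (g gamma theta tau : R) (u : 'cV[R]_6).

Lemma froude_sqr g u : 0 < g -> 0 < h1 u ->
  g * h1 u * (Fx g u ^+ 2 + Fy g u ^+ 2) =
  (u2 u - u1 u) ^+ 2 + (v2 u - v1 u) ^+ 2.
Proof.
move=> g0 h10; have gh : 0 < g * h1 u by rewrite mulr_gt0.
rewrite /Fx /Fy !expr_div_n sqr_sqrtr ?ltW// -mulrDl mulrC divfK//.
by rewrite gt_eqF.
Qed.

(** All pairs of roots are at distance at least 1 / L, so the discriminant, a
    product of six squared differences, is bounded below; [zcrit_margin]
    concludes. *)
Lemma stable_margin g gamma (m M c : R) : 0 < g -> 0 < gamma < 1 ->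
  0 < m -> m <= M -> 0 < c ->
  exists2 delta, 0 < delta & forall u, m <= h1 u <= M -> m <= h2 u <= M ->
    stable g gamma u c ->
    Fx g u ^+ 2 + Fy g u ^+ 2 + delta <= zcrit (h2 u / h1 u) gamma.
Proof.
move=> g0 g01 m0 mM c0; case/andP: (g01) => gam0 gam1.
have M0 : 0 < M by apply: lt_le_trans mM.
pose H := M / m; pose K := Num.sqrt (g * M) / m; pose B := 2 + 2 * Num.sqrt H.
have H0 : 0 < H by rewrite divr_gt0.
have K0 : 0 <= K by rewrite divr_ge0 ?sqrtr_ge0 ?ltW.
have sH0 := sqrtr_ge0 H.
pose L := c * (2 * B + 2 * (K * (2 + 5 * B ^+ 2))).
have L0 : 0 < L.
  rewrite mulr_gt0// ltr_pwDl//; first by rewrite /B; lra.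
  by rewrite mulr_ge0// mulr_ge0// addr_ge0// mulr_ge0// sqr_ge0.
have d0 : 0 < ((L^-1) ^+ 6) ^+ 2 by rewrite !exprn_gt0// invr_gt0.
have [delta delta0 Hd] := zcrit_margin g01 H0 d0.
exists delta => // u /andP[h1m h1M] /andP[h2m h2M] Pu.
have h10 : 0 < h1 u by apply: lt_le_trans h1m.
have h20 : 0 < h2 u by apply: lt_le_trans h2m.
have h0 : 0 < h2 u / h1 u by rewrite divr_gt0.
have hH : h2 u / h1 u <= H.
  by rewrite ler_pM ?invr_ge0 ?(ltW h10) ?(ltW h20)// lef_pV2.
have Fr0 : 0 <= Fx g u ^+ 2 + Fy g u ^+ 2 by rewrite addr_ge0 ?sqr_ge0.
rewrite -(sqr_sqrtr Fr0); apply: Hd; rewrite ?h0 ?sqrtr_ge0//.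
move=> F /andP[F0 FFr] Fz.
set c1 := Num.sqrt (g * h1 u).
have c1E : c1 ^+ 2 = g * h1 u by rewrite sqr_sqrtr// mulr_ge0 ?ltW.
have c1M : c1 <= Num.sqrt (g * M) by rewrite ler_wsqrtr// ler_pM2l.
have c1K h : m <= h -> c1 / h <= K.
  move=> mh; have h_gt0 : 0 < h by apply: lt_le_trans mh.
  by rewrite ler_pM ?sqrtr_ge0 ?invr_ge0 ?(ltW h_gt0)// lef_pV2.
have FU : (c1 * F) ^+ 2 <= (u2 u - u1 u) ^+ 2 + (v2 u - v1 u) ^+ 2.
  rewrite exprMn c1E -(froude_sqr g0 h10) ler_pM2l ?mulr_gt0//.
  by rewrite -(sqr_sqrtr Fr0) ler_sqr ?nnegrE ?sqrtr_ge0.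
have F1 := subcritical_le h0 g01 F0 (ltW Fz).
have shH : Num.sqrt (h2 u / h1 u) <= Num.sqrt H by rewrite ler_wsqrtr.
have [s1 [s2 [s3 [s4 [[n12 n13 n14 n23 n24] [n34 roots]]]]]] :=
  four_roots_of_lt_zcrit h0 g01 F0 Fz.
rewrite (discriminant_roots roots).
have [p1 p2 p3 p4] := dispersion_roots_eq0 roots.
have rB s : dispersion F (h2 u / h1 u) gamma s = 0 -> `|s| <= B.
  by move=> /(dispersion_root_lt F0 h0 gam1) sB; rewrite /B; lra.
have FB : `|F| <= B by rewrite ger0_norm// /B; lra.
have gap s t : s != t -> dispersion F (h2 u / h1 u) gamma s = 0 ->
    dispersion F (h2 u / h1 u) gamma t = 0 -> L^-1 <= `|s - t|.
  move=> st ps pt; rewrite -div1r ler_pdivrMr// mulrC.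
  exact: (stable_root_gap g0 h10 h20 Pu (ltW c0) K0 (c1K _ h1m) (c1K _ h2m) FU FB
    (rB _ ps) (rB _ pt) st ps pt).
rewrite -[leRHS]real_normK ?num_real// ler_sqr ?nnegrE ?exprn_ge0 ?invr_ge0 ?(ltW L0)//.
rewrite !normrM (_ : L^-1 ^+ 6 = L^-1 * L^-1 * L^-1 * L^-1 * L^-1 * L^-1); last by ring.
have Li : 0 <= L^-1 by rewrite invr_ge0 ltW.
by repeat first [exact: gap|exact: Li|apply: mulr_ge0|apply: ler_pM].
Qed.

Lemma sqr_direction_le (theta a b : R) :
  (cos theta * a + sin theta * b) ^+ 2 <= a ^+ 2 + b ^+ 2.
Proof.
have := cos2Dsin2 theta; have := sqr_ge0 (sin theta * a - cos theta * b).
move: (cos theta) (sin theta) => C S H1 H2.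
have -> : a ^+ 2 + b ^+ 2 = (C ^+ 2 + S ^+ 2) * (a ^+ 2 + b ^+ 2).
  by rewrite H2 mul1r.
rewrite -subr_ge0; apply: le_trans H1 _.
by rewrite le_eqVlt; apply/orP; left; apply/eqP; ring.
Qed.

Lemma dispersion_root_lt_norm (F h gamma s : R) : 0 < h -> gamma < 1 ->
  dispersion F h gamma s = 0 -> `|s| < 1 + `|F| + Num.sqrt h.
Proof.
move=> h0 g1 ps; have [F0|F0] := leP 0 F.
  by rewrite (ger0_norm F0); exact: (dispersion_root_lt F0 h0 g1 ps).
rewrite -normrN (ltr0_norm F0); apply: (dispersion_root_lt _ h0 g1).
  by rewrite oppr_ge0 ltW.
by rewrite -ps /dispersion -opprD !sqrrN.
Qed.

(** The projected Froude number is at most the norm of (Fx, Fy), so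
    [uniform_gaps] applies in all directions with the same constants. The bounds
    on the velocity differences that [propagator_bounded] needs follow from
    subcriticality and from the bounds on the depths. *)
Lemma margin_stable g gamma (m M delta : R) : 0 < g -> 0 < gamma < 1 ->
  0 < m -> m <= M -> 0 < delta ->
  exists2 c, 0 < c & forall u, m <= h1 u <= M -> m <= h2 u <= M ->
    Fx g u ^+ 2 + Fy g u ^+ 2 + delta <= zcrit (h2 u / h1 u) gamma ->
    stable g gamma u c.
Proof.
move=> g0 g01 m0 mM delta0; case/andP: (g01) => gam0 gam1.
have M0 : 0 < M by apply: lt_le_trans mM.
pose H := M / m.
have mH : (m / M) <= H.
  apply: (@le_trans _ _ 1); first by rewrite ler_pdivrMr// mul1r.
  by rewrite ler_pdivlMr// mul1r.
have mM0 : 0 < m / M by rewrite divr_gt0.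
have [d d0 gaps] := uniform_gaps g01 mM0 mH delta0.
pose B := g + M + Num.sqrt (g * M) * (2 + 2 * Num.sqrt H).
have sH0 := sqrtr_ge0 H; have sM0 := sqrtr_ge0 (g * M).
have Bs0 : 0 <= Num.sqrt (g * M) * (2 + 2 * Num.sqrt H).
  by rewrite mulr_ge0// addr_ge0// mulr_ge0.
have B0 : 0 < B by rewrite /B; lra.
pose D := Num.sqrt (g * m) * d.
have D0 : 0 < D by rewrite mulr_gt0// sqrtr_gt0 mulr_gt0.
exists (2 * (2 * (73 * B) / D) ^+ 3 + 2).
  by rewrite ltr_wpDl// mulr_ge0// exprn_ge0// !mulr_ge0 ?invr_ge0 ?ltW.
move=> u /andP[h1m h1M] /andP[h2m h2M] Fz theta _.
have h10 : 0 < h1 u by apply: lt_le_trans h1m.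
have h20 : 0 < h2 u by apply: lt_le_trans h2m.
have h0 : 0 < h2 u / h1 u by rewrite divr_gt0.
have hH : m / M <= h2 u / h1 u <= H.
  by apply/andP; split; rewrite ler_pM ?invr_ge0 ?(ltW h10) ?(ltW h20)
    ?(ltW m0) ?(ltW M0)// lef_pV2.
set c1 := Num.sqrt (g * h1 u).
have gh0 : 0 < g * h1 u by rewrite mulr_gt0.
have c10 : 0 < c1 by rewrite sqrtr_gt0.
have c1E : c1 ^+ 2 = g * h1 u by rewrite sqr_sqrtr// ltW.
have c1M : c1 <= Num.sqrt (g * M) by rewrite ler_wsqrtr// ler_pM2l.
have c1m : Num.sqrt (g * m) <= c1 by rewrite ler_wsqrtr// ler_pM2l.
pose F := (vel2 u theta - vel1 u theta) / c1.
have UF : vel2 u theta - vel1 u theta = c1 * F by rewrite mulrC divfK ?gt_eqF.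
have FFr : F ^+ 2 <= Fx g u ^+ 2 + Fy g u ^+ 2.
  rewrite -(ler_pM2l gh0) froude_sqr// -c1E -exprMn -UF vel_direction.
  exact: sqr_direction_le.
have [|s1 [s2 [s3 [s4 [s12 s23 s34 roots]]]]] := gaps (h2 u / h1 u) F hH.
  by apply: le_trans Fz; rewrite lerD2r.
have shH : Num.sqrt (h2 u / h1 u) <= Num.sqrt H.
  by rewrite ler_wsqrtr//; case/andP: hH.
have absF (x : R) : x ^+ 2 <= Fx g u ^+ 2 + Fy g u ^+ 2 -> `|x| <= 1 + Num.sqrt H.
  move=> xF; apply: (@le_trans _ _ (1 + Num.sqrt (h2 u / h1 u))); last by lra.
  apply: (subcritical_le h0 g01) => //; rewrite real_normK ?num_real//; lra.
have velB x : (x / c1) ^+ 2 <= Fx g u ^+ 2 + Fy g u ^+ 2 -> `|x| <= B.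
  move=> /absF; rewrite normrM normfV (gtr0_norm c10) ler_pdivrMr// => xB.
  apply: (le_trans xB); rewrite mulrC.
  apply: (@le_trans _ _ (Num.sqrt (g * M) * (1 + Num.sqrt H))).
    by rewrite ler_wpM2r// addr_ge0.
  have : Num.sqrt (g * M) * (1 + Num.sqrt H) <=
         Num.sqrt (g * M) * (2 + 2 * Num.sqrt H) by rewrite ler_wpM2l//; lra.
  rewrite /B; lra.
apply: (propagator_bounded g0 h10 h20 D0 _ _ _ _ _ _ UF roots).
- by rewrite /B; lra.
- rewrite gtr0_norm ?mulr_gt0//.
  by apply: (@le_trans _ _ (1 * g)); [rewrite ler_pM2r// ltW|rewrite /B; lra].
- by rewrite /B; lra.
- by rewrite /B; lra.
- by apply: velB; rewrite lerDl sqr_ge0.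
- by apply: velB; rewrite lerDr sqr_ge0.
- have : D <= c1 * d by rewrite ler_pM2r.
  have : c1 * (s1 + d) <= c1 * s2 by rewrite ler_pM2l.
  rewrite -/c1 mulrDr; lra.
- have : D <= c1 * d by rewrite ler_pM2r.
  have : c1 * (s2 + d) <= c1 * s3 by rewrite ler_pM2l.
  rewrite -/c1 mulrDr; lra.
- have : D <= c1 * d by rewrite ler_pM2r.
  have : c1 * (s3 + d) <= c1 * s4 by rewrite ler_pM2l.
  rewrite -/c1 mulrDr; lra.
- move=> s ss; have ps : dispersion F (h2 u / h1 u) gamma s = 0.
    have [p1 p2 p3 p4] := dispersion_roots_eq0 roots.
    by move: ss; rewrite !inE => /or4P[]/eqP->.
  have := dispersion_root_lt_norm h0 gam1 ps; have := absF _ FFr => FH sB.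
  rewrite normrM (gtr0_norm c10).
  apply: (@le_trans _ _ (Num.sqrt (g * M) * (2 + 2 * Num.sqrt H))).
    by rewrite ler_pM// ?(ltW c10)//; lra.
  rewrite /B; lra.
Qed.

Lemma ereal_inf_gt0 (T : Type) (f : T -> R) (x0 : T) :
  (0 < ereal_inf [set (f X)%:E | X in [set: T]])%E <->
  exists2 delta, 0 < delta & forall X, delta <= f X.
Proof.
split=> [|[delta d0 df]]; last first.
  apply: (@lt_le_trans _ _ delta%:E); first by rewrite lte_fin.
  by apply: le_ereal_inf_tmp => _ [X _ <-]; rewrite lee_fin.
have lb X : (ereal_inf [set (f X)%:E | X in [set: T]] <= (f X)%:E)%E.
  by apply: ereal_inf_lbound; exists X.
move: (ereal_inf _) lb => [r lb r0|lb|lb //]; last by have := lb x0.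
by exists r => [|X]; [rewrite -lte_fin|rewrite -lee_fin].
Qed.

End Uniform.


Theorem theorem3p7 (R : realType) (g rho1 rho2 gamma : R)
    (g_gt0 : 0 < g) (rho1_gt0 : 0 < rho1) (rho2_gt0 : 0 < rho2)
    (gammaE : gamma = rho1 / rho2)
    (u0 : R * R -> 'cV[R]_6)
    (u0_meas : forall j, measurable_fun setT (fun X => u0 X j 0))
    (u0_ess : values_essential u0)
    (h_gt0 : forall X, 0 < h1 (u0 X) /\ 0 < h2 (u0 X))
    (h_bnd : exists M : R, forall X, h1 (u0 X) <= M /\ h2 (u0 X) <= M) :
  hyperbolic g gamma u0 <->
  [/\ 0 < gamma < 1,
      (0 < ereal_inf [set (h1 (u0 X))%:E | X in [set: R * R]])%E /\
      (0 < ereal_inf [set (h2 (u0 X))%:E | X in [set: R * R]])%E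
    & (0 < ereal_inf [set (Fcrit_minus0 gamma (u0 X) ^+ 2
                           - Fx g (u0 X) ^+ 2 - Fy g (u0 X) ^+ 2)%:E
                     | X in [set: R * R]])%E].
Proof.
have [M hM] := h_bnd; have gam0 : 0 < gamma by rewrite gammaE divr_gt0.
have X0 : R * R := (0, 0).
have FE X : 0 < gamma < 1 -> Fcrit_minus0 gamma (u0 X) ^+ 2 =
    zcrit (h2 (u0 X) / h1 (u0 X)) gamma.
  by move=> g01; have [? ?] := h_gt0 X; rewrite Fcrit_minus_sqr// divr_gt0.
split=> [hyp|[g01 [/(ereal_inf_gt0 _ X0) [m1 m10 mh1]
    /(ereal_inf_gt0 _ X0) [m2 m20 mh2]] /(ereal_inf_gt0 _ X0) [delta d0 dF]]].
- have [c c0 Pc] := hyperbolic_stable u0_meas u0_ess hyp.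
  have g01 : 0 < gamma < 1.
    rewrite gam0; have [h10 h20] := h_gt0 X0.
    exact: stable_gamma_lt1 g_gt0 h10 h20 gam0 (Pc X0).
  have [m m0 mh] : exists2 m, 0 < m &
      forall X, m <= h1 (u0 X) /\ m <= h2 (u0 X).
    exists ((1 - gamma) * gamma ^+ 2 * g / (8 * c ^+ 2)) => [|X].
      case/andP: g01 => _ g1.
      by rewrite divr_gt0 ?mulr_gt0 ?exprn_gt0 ?subr_gt0.
    have [h10 h20] := h_gt0 X.
    have := stable_depth g_gt0 h10 h20 g01 c0 (Pc X).
    by rewrite le_min => /andP.
  split=> //.
  + by split; apply/(ereal_inf_gt0 _ X0); exists m => // X; have [] := mh X.
  + have mM : m <= M by have [+ _] := mh X0; have [+ _] := hM X0; lra.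
    have [delta d0 Hd] := stable_margin g_gt0 g01 m0 mM c0.
    apply/(ereal_inf_gt0 _ X0); exists delta => // X.
    have [a b] := mh X; have [a' b'] := hM X.
    have := Hd (u0 X); rewrite a b a' b' => /(_ erefl erefl (Pc X)).
    by rewrite FE//; lra.
- pose m := Num.min m1 m2.
  have m0 : 0 < m by rewrite lt_min m10.
  have mh X : m <= h1 (u0 X) /\ m <= h2 (u0 X).
    by split; [apply: le_trans (mh1 X)|apply: le_trans (mh2 X)];
      rewrite ge_min lexx ?orbT.
  have mM : m <= M by have [+ _] := mh X0; have [+ _] := hM X0; lra.
  have [c c0 Hc] := margin_stable g_gt0 g01 m0 mM d0.
  apply: (stable_hyperbolic c0) => X; apply: Hc.
  + by have [-> _] := mh X; have [-> _] := hM X.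
  + by have [_ ->] := mh X; have [_ ->] := hM X.
  + by have := dF X; rewrite FE//; lra.
Qed.
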